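(* Let $\mathcal{A}$ be an artinian abelian category, $S$ a set of prime numbers, and $\mathcal{A}_S$ the $S$-primary torsion subcategory of $\mathcal{A}$. Then \[ \mathrm{hd}(\mathcal{A}) = \max\big(\mathrm{hd}(\mathcal{A}_S), \mathrm{hd}(\mathcal{A}/\mathcal{A}_S)\big). \]
   Context: An abelian category is artinian if every descending chain of subobjects of every object is stationary. $\langle S \rangle$ is the set of positive integers all of whose prime factors lie in $S$. $\mathcal{A}_S$ is the full subcategory of $\mathcal{A}$ whose objects are the $X$ such that multiplication by $n$, $n_X : X \to X$, is zero for some $n \in \langle S \rangle$; it is a Serre subcategory (stable under subobjects, quotients and extensions), and $\mathcal{A}/\mathcal{A}_S$ is the Serre–Gabriel quotient category. The homological dimension $\mathrm{hd}(\mathcal{B})$ of an abelian category $\mathcal{B}$ is the smallest non-negative integer $n$ such that the Yoneda extension groups $\mathrm{Ext}^i_{\mathcal{B}}(X,Y)$ vanish for all $X,Y \in \mathcal{B}$ and all $i > n$, and $\infty$ if there is no such $n$. *)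

(* Defs.v *)
From HB Require Import structures.
From Stdlib Require Import Relation_Operators.
From mathcomp Require Import all_boot all_algebra.
From mathcomp Require Import ring boolp classical_sets.

Set Implicit Arguments.
Unset Strict Implicit.
Unset Printing Implicit Defensive.

Import GRing.Theory.
Local Open Scope ring_scope.
Local Open Scope quotient_scope.

Record preadditive := Preadditive {
  obj :> Type;
  hom : obj -> obj -> zmodType;
  idm : forall X, hom X X;
  comp : forall X Y Z, hom Y Z -> hom X Y -> hom X Z;
  compA : forall X Y Z T (h : hom Z T) (g : hom Y Z) (f : hom X Y),
    comp h (comp g f) = comp (comp h g) f;
  comp1m : forall X Y (f : hom X Y), comp (idm Y) f = f;
  compm1 : forall X Y (f : hom X Y), comp f (idm X) = f;
  compDl : forall X Y Z (g g' : hom Y Z) (f : hom X Y),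
    comp (g + g') f = comp g f + comp g' f;
  compDr : forall X Y Z (g : hom Y Z) (f f' : hom X Y),
    comp g (f + f') = comp g f + comp g f'
}.

Arguments hom {p} X Y.
Arguments idm {p} X.
Arguments comp {p X Y Z} g f.

Notation "g \oc f" := (comp g f) (at level 40, left associativity).

Section Preadditive.
Context {A : preadditive}.
Implicit Types X Y Z W : A.

Definition mono X Y (m : hom X Y) : Prop :=
  forall W (u v : hom W X), m \oc u = m \oc v -> u = v.

Definition epi X Y (e : hom X Y) : Prop :=
  forall W (u v : hom Y W), u \oc e = v \oc e -> u = v.

Definition zero_object Z : Prop :=
  (forall X (f : hom X Z), f = 0) /\ (forall X (f : hom Z X), f = 0).

Definition is_biproduct X1 X2 P (i1 : hom X1 P) (i2 : hom X2 P)
    (p1 : hom P X1) (p2 : hom P X2) : Prop :=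
  [/\ p1 \oc i1 = idm X1, p2 \oc i2 = idm X2, p2 \oc i1 = 0, p1 \oc i2 = 0 &
      i1 \oc p1 + i2 \oc p2 = idm P].

Definition is_kernel X Y (f : hom X Y) K (k : hom K X) : Prop :=
  f \oc k = 0 /\
  forall W (g : hom W X), f \oc g = 0 -> exists! u : hom W K, k \oc u = g.

Definition is_cokernel X Y (f : hom X Y) C (c : hom Y C) : Prop :=
  c \oc f = 0 /\
  forall W (g : hom Y W), g \oc f = 0 -> exists! u : hom C W, u \oc c = g.

Definition is_image X Y (f : hom X Y) I (m : hom I Y) : Prop :=
  exists C (c : hom Y C), is_cokernel f c /\ is_kernel c m.

Definition exact X Y Z (f : hom X Y) (g : hom Y Z) : Prop :=
  exists I (m : hom I Y), is_image f m /\ is_kernel g m.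

(* A descending chain of subobjects of X is given by representing
   monomorphisms m k; it is stationary when m k.+1 factors m k for large k,
   that is, when m k and m k.+1 represent the same subobject. *)
Definition artinian : Prop :=
  forall X (D : nat -> A) (m : forall k, hom (D k) X),
    (forall k, mono (m k)) ->
    (forall k, exists u : hom (D k.+1) (D k), m k \oc u = m k.+1) ->
    exists N, forall k, (N <= k)%N ->
      exists v : hom (D k) (D k.+1), m k.+1 \oc v = m k.

End Preadditive.

Arguments artinian A : clear implicits.

Record abelian := Abelian {
  abelian_cat :> preadditive;
  abelian_zero : exists Z : abelian_cat, zero_object Z;
  abelian_biproduct : forall X1 X2 : abelian_cat,
    exists P (i1 : hom X1 P) (i2 : hom X2 P) (p1 : hom P X1) (p2 : hom P X2),
      is_biproduct i1 i2 p1 p2;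
  abelian_kernel : forall (X Y : abelian_cat) (f : hom X Y),
    exists K (k : hom K X), is_kernel f k;
  abelian_cokernel : forall (X Y : abelian_cat) (f : hom X Y),
    exists C (c : hom Y C), is_cokernel f c;
  abelian_mono : forall (X Y : abelian_cat) (m : hom X Y),
    mono m -> exists Z (g : hom Y Z), is_kernel g m;
  abelian_epi : forall (X Y : abelian_cat) (e : hom X Y),
    epi e -> exists Z (f : hom Z X), is_cokernel f e
}.

(** * Yoneda extensions and homological dimension

    All notions below are intrinsic to the preadditive category; they are
    meant for categories that are abelian. *)

Section Yoneda.
Context {A : preadditive}.
Implicit Types X Y : A.

(* Y -> E_1 -> ... -> E_n -> X *)
Fixpoint chain n Y X : Type :=
  if n is m.+1 then {E : A & (hom Y E * chain m E X)%type} else hom Y X.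

(* V -f-> Y -> E_1 -> ... -> E_n -> X -> 0 is exact at Y, E_1, ..., E_n, X *)
Fixpoint exact_from n V Y X (f : hom V Y) : chain n Y X -> Prop :=
  match n with
  | 0 => fun g => exact f g /\ epi g
  | m.+1 => fun c =>
      exact f (projT2 c).1 /\ exact_from (projT2 c).1 (projT2 c).2
  end.

(* 0 -> Y -> E_0 -> E_1 -> ... -> E_n -> X -> 0 is exact *)
Definition exact_chain n Y X (c : chain n.+1 Y X) : Prop :=
  mono (projT2 c).1 /\ exact_from (projT2 c).1 (projT2 c).2.

(* Existence of a commutative ladder between two chains with the same end X,
   with u at the start and the identity of X at the end. *)
Fixpoint chain_map n Y Y' X (u : hom Y Y') : chain n Y X -> chain n Y' X -> Prop :=
  match n with
  | 0 => fun g g' => g = g' \oc u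
  | m.+1 => fun c c' =>
      exists2 v : hom (projT1 c) (projT1 c'),
        v \oc (projT2 c).1 = (projT2 c').1 \oc u &
        chain_map v (projT2 c).2 (projT2 c').2
  end.

(* Extensions of X by Y of length n.+1. *)
Definition extension n X Y : Type := {c : chain n.+1 Y X | exact_chain c}.

HB.instance Definition _ n X Y := gen_eqMixin (extension n X Y).
HB.instance Definition _ n X Y := gen_choiceMixin (extension n X Y).

Definition extension_map n X Y (E E' : extension n X Y) : Prop :=
  chain_map (idm Y) (sval E) (sval E').

Definition yoneda_rel n X Y : rel (extension n X Y) :=
  fun E E' => `[< clos_refl_sym_trans _ (@extension_map n X Y) E E' >].

Lemma yoneda_rel_refl n X Y : reflexive (@yoneda_rel n X Y).
Proof. by move=> E; apply/asboolP; exact: rst_refl. Qed.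

Lemma yoneda_rel_sym n X Y : symmetric (@yoneda_rel n X Y).
Proof. by move=> E F; apply/asboolP/asboolP; exact: rst_sym. Qed.

Lemma yoneda_rel_trans n X Y : transitive (@yoneda_rel n X Y).
Proof.
by move=> F E G /asboolP EF /asboolP FG; apply/asboolP; exact: rst_trans EF FG.
Qed.

Canonical yoneda_equiv n X Y := EquivRel (@yoneda_rel n X Y)
  (@yoneda_rel_refl n X Y) (@yoneda_rel_sym n X Y) (@yoneda_rel_trans n X Y).

(* Only the underlying set of the group is needed: a group vanishes if and
   only if any two of its elements are equal. *)
Definition Ext n X Y : Type :=
  if n is m.+1 then {eq_quot (@yoneda_equiv m X Y)} else hom X Y.

End Yoneda.

Definition Ext_vanishes_above (B : preadditive) (n : nat) : Prop :=
  forall (X Y : B) (i : nat), (n < i)%N -> forall a b : Ext i X Y, a = b.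

Lemma asbool_ex (P : nat -> Prop) : (exists n, P n) -> exists n, `[< P n >].
Proof. by case=> n Pn; exists n; apply/asboolP. Qed.

(* The value None stands for infinity. *)
Definition hd (B : preadditive) : option nat :=
  if pselect (exists n, Ext_vanishes_above B n) is left h
  then Some (ex_minn (asbool_ex h)) else None.

Definition maxo (m n : option nat) : option nat :=
  if (m, n) is (Some m', Some n') then Some (maxn m' n') else None.

(** * Torsion subcategory *)

(* The set <S>. *)
Definition generated (S : set nat) (n : nat) : Prop :=
  (0 < n)%N /\ forall p, prime p -> (p %| n)%N -> S p.

Definition is_torsion (A : preadditive) (S : set nat) (X : A) : Prop :=
  exists2 n, generated S n & idm X *+ n = 0.

Definition full_subcategory (A : preadditive) (P : A -> Prop) : preadditive :=
  @Preadditive {X : A | P X} (fun X Y => hom (sval X) (sval Y))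
    (fun X => idm (sval X)) (fun _ _ _ g f => g \oc f)
    (fun _ _ _ _ => @compA A _ _ _ _) (fun _ _ => @comp1m A _ _)
    (fun _ _ => @compm1 A _ _) (fun _ _ _ => @compDl A _ _ _)
    (fun _ _ _ => @compDr A _ _ _).

Definition torsion_subcategory (A : preadditive) (S : set nat) : preadditive :=
  full_subcategory (@is_torsion A S).

(** * Serre quotient by the torsion subcategory

    The quotient is the localization of A at the morphisms s whose kernel and
    cokernel are torsion: its objects are those of A, and a morphism X -> Y is
    a class of roofs X <-s- W -f-> Y. *)

Section PreadditiveTheory.
Context {A : preadditive}.
Implicit Types X Y Z : A.

Lemma comp0l X Y Z (f : hom X Y) : (0 : hom Y Z) \oc f = 0.
Proof. by apply: (addrI (0 \oc f)); rewrite -compDl !addr0. Qed.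

Lemma comp0r X Y Z (g : hom Y Z) : g \oc (0 : hom X Y) = 0.
Proof. by apply: (addrI (g \oc 0)); rewrite -compDr !addr0. Qed.

Lemma compNl X Y Z (g : hom Y Z) (f : hom X Y) : (- g) \oc f = - (g \oc f).
Proof. by apply: (addrI (g \oc f)); rewrite -compDl !subrr comp0l. Qed.

Lemma compNr X Y Z (g : hom Y Z) (f : hom X Y) : g \oc (- f) = - (g \oc f).
Proof. by apply: (addrI (g \oc f)); rewrite -compDr !subrr comp0r. Qed.

Lemma compMnl X Y Z (g : hom Y Z) (f : hom X Y) n : (g *+ n) \oc f = (g \oc f) *+ n.
Proof. by elim: n => [|n IHn]; rewrite ?mulr0n ?comp0l // !mulrS compDl IHn. Qed.

Lemma compMnr X Y Z (g : hom Y Z) (f : hom X Y) n : g \oc (f *+ n) = (g \oc f) *+ n.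
Proof. by elim: n => [|n IHn]; rewrite ?mulr0n ?comp0r // !mulrS compDr IHn. Qed.

End PreadditiveTheory.

Definition compMn := (@compMnl, @compMnr).

Lemma generated1 S : generated S 1.
Proof. by split=> // p p_pr; rewrite dvdn1 => /eqP p1; rewrite p1 in p_pr. Qed.

Lemma generatedM S m n : generated S m -> generated S n -> generated S (m * n).
Proof.
move=> [m0 Sm] [n0 Sn]; split=> [|p p_pr]; first by rewrite muln_gt0 m0.
by rewrite Euclid_dvdM // => /orP[]; [exact: Sm | exact: Sn].
Qed.

(* Morphisms that become invertible in the quotient by the objects in P. *)
Definition iso_mod (A : preadditive) (P : A -> Prop) (X Y : A) (s : hom X Y) : Prop :=
  (exists K (k : hom K X), is_kernel s k /\ P K) /\
  (exists C (c : hom Y C), is_cokernel s c /\ P C).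

Section SerreQuotient.
Context (A : abelian) (S : set nat).
Implicit Types X Y Z W : A.

Let Sig X Y (s : hom X Y) : Prop := iso_mod (@is_torsion A S) s.

Lemma iso_mod_torsionP X Y (s : hom X Y) :
  Sig s <-> exists N (g : hom Y X),
    [/\ generated S N, s \oc g = idm Y *+ N & g \oc s = idm X *+ N].
Proof.
split=> [[[K [k [[sk0 k_ker] [n Sn Kn]]]] [C [c [[cs0 c_coker] [m Sm Cm]]]]]|].
  have [I [e [ek0 e_coker]]] := abelian_cokernel k.
  have e_epi : epi e.
    move=> W u v uv; have [w [_ w_uniq]] := e_coker _ (v \oc e) ltac:(
      by rewrite -compA ek0 comp0r).
    by rewrite -(w_uniq _ uv) (w_uniq v).
  have [m' [m'e _]] := e_coker _ s sk0.
  have m'_mono : mono m'.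
    suff m'0 W (x : hom W I) : m' \oc x = 0 -> x = 0.
      move=> W u v uv; apply/eqP; rewrite -subr_eq0; apply/eqP/m'0.
      by rewrite compDr compNr uv subrr.
    move=> m'x; have [Q [q [qx0 q_coker]]] := abelian_cokernel x.
    have [m'' [m''q _]] := q_coker _ _ m'x.
    have q_epi : epi q.
      move=> V u v uv; have [w [_ w_uniq]] := q_coker _ (v \oc q) ltac:(
        by rewrite -compA qx0 comp0r).
      by rewrite -(w_uniq _ uv) (w_uniq v).
    have qe_epi : epi (q \oc e).
      by move=> V u v; rewrite !compA => /e_epi /q_epi.
    have [V [h [qeh0 h_coker]]] := abelian_epi qe_epi.
    have sh0 : s \oc h = 0.
      by rewrite -m'e -m''q -!compA (compA q e h) qeh0 comp0r.
    have [t [kt _]] := k_ker _ h sh0.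
    have eh0 : e \oc h = 0 by rewrite -kt compA ek0 comp0l.
    have [r [rqe _]] := h_coker _ e eh0.
    have rq : r \oc q = idm I by apply: e_epi; rewrite -compA rqe comp1m.
    by rewrite -[x]comp1m -rq -compA qx0 comp0r.
  have kn0 : k *+ n = 0 by rewrite -[k]compm1 -compMnr Kn comp0r.
  have cm0 : c *+ m = 0 by rewrite -[c]comp1m -compMnl Cm comp0l.
  have [g1 [g1e _]] := e_coker _ (idm X *+ n) ltac:(
    by rewrite compMnl comp1m kn0).
  have [D [d [dm'0 d_ker]]] := abelian_mono m'_mono.
  have [d' [d'c _]] := c_coker _ d ltac:(by rewrite -m'e compA dm'0 comp0l).
  have [g2 [m'g2 _]] := d_ker _ (idm Y *+ m) ltac:(
    by rewrite compMnr compm1 -d'c -compMnr cm0 comp0r).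
  have eg1 : e \oc g1 = idm I *+ n.
    by apply: e_epi; rewrite -compA g1e !compMn compm1 comp1m.
  have g2m' : g2 \oc m' = idm I *+ m.
    by apply: m'_mono; rewrite compA m'g2 !compMn compm1 comp1m.
  exists (n * m)%N, (g1 \oc g2); split; first exact: generatedM.
    rewrite -m'e -compA (compA e) eg1 compMnl comp1m compMnr m'g2.
    by rewrite -mulrnA mulnC.
  by rewrite -{1}m'e -compA (compA g2) g2m' compMnl comp1m compMnr g1e mulrnA.
move=> [N [g [SN sg gs]]]; split.
  have [K [k [sk0 k_ker]]] := abelian_kernel s.
  exists K, k; split=> //; exists N => //.
  have [u [_ u_uniq]] := k_ker _ (0 : hom K X) (comp0r _ _).
  rewrite -(u_uniq 0) ?comp0r //; symmetry; apply: u_uniq.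
  by rewrite compMnr compm1 -[k]comp1m -compMnl -gs -compA sk0 comp0r.
have [C [c [cs0 c_coker]]] := abelian_cokernel s.
exists C, c; split=> //; exists N => //.
have [u [_ u_uniq]] := c_coker _ (0 : hom Y C) (comp0l _ _).
rewrite -(u_uniq 0) ?comp0l //; symmetry; apply: u_uniq.
by rewrite compMnl comp1m -[c]compm1 -compMnr -sg compA cs0 comp0l.
Qed.

Lemma Sig_muln X N : generated S N -> Sig (idm X *+ N).
Proof.
move=> SN; apply/iso_mod_torsionP; exists N, (idm X).
by rewrite comp1m compm1.
Qed.

Lemma Sig1 X : Sig (idm X).
Proof. exact: (Sig_muln X (generated1 S)). Qed.

Lemma Sig_comp X Y Z (t : hom Y Z) (s : hom X Y) : Sig t -> Sig s -> Sig (t \oc s).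
Proof.
move=> /iso_mod_torsionP[M [h [SM th ht]]] /iso_mod_torsionP[N [g [SN sg gs]]].
apply/iso_mod_torsionP; exists (M * N)%N, (g \oc h); split.
- exact: generatedM.
- by rewrite -compA (compA s) sg compMnl comp1m compMnr th mulrnA.
- by rewrite -compA (compA h) ht compMnl comp1m compMnr gs -mulrnA mulnC.
Qed.

(* X <-den- apex -num-> Y *)
Record roof X Y := Roof {
  apex : A;
  den : hom apex X;
  num : hom apex Y;
  denP : Sig den
}.

HB.instance Definition _ X Y := gen_eqMixin (roof X Y).
HB.instance Definition _ X Y := gen_choiceMixin (roof X Y).

Definition roof_equiv X Y (r r' : roof X Y) : Prop :=
  exists V (u : hom V (apex r)) (u' : hom V (apex r')),
    [/\ den r \oc u = den r' \oc u', num r \oc u = num r' \oc u' &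
        Sig (den r \oc u)].

(* The roof r stands for the fraction h / N; used only in proofs. *)
Definition frac X Y (r : roof X Y) (N : nat) (h : hom X Y) : Prop :=
  generated S N /\ h \oc den r = num r *+ N.

Lemma frac_ex X Y (r : roof X Y) : exists N h, frac r N h.
Proof.
have /iso_mod_torsionP[N [g [SN _ gs]]] := denP r.
by exists N, (num r \oc g); split; rewrite // -compA gs compMnr compm1.
Qed.

Lemma frac_equiv X Y (r r' : roof X Y) N h N' h' :
  frac r N h -> frac r' N' h' ->
  roof_equiv r r' <-> exists2 M, generated S M & h *+ (N' * M) = h' *+ (N * M).
Proof.
move=> [SN hN] [SN' hN']; split.
  move=> [V [u [u' [eq_den eq_num /iso_mod_torsionP[L [k [SL uk _]]]]]]].
  exists L => //; rewrite !mulrnA.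
  have E : (h *+ N') \oc (den r \oc u) = (h' *+ N) \oc (den r \oc u).
    rewrite {2}eq_den !compMn !compA hN hN' !compMnl eq_num.
    by rewrite -!mulrnA mulnC.
  move: (congr1 (fun x => x \oc k) E); rewrite -!(compA (_ *+ _)) uk.
  by rewrite !compMnr !compm1.
move=> [M SM E].
have /iso_mod_torsionP[K [g [SK sg gs]]] := denP r.
have /iso_mod_torsionP[K' [g' [SK' sg' gs']]] := denP r'.
have fg : (num r \oc g) *+ N = h *+ K.
  by rewrite -compMnl -hN -compA sg compMnr compm1.
have fg' : (num r' \oc g') *+ N' = h' *+ K'.
  by rewrite -compMnl -hN' -compA sg' compMnr compm1.
exists X, (g *+ (K' * M * N * N')), (g' *+ (K * M * N * N')).
rewrite !compMnr sg sg' -!mulrnA; split.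
- by congr (_ *+ _); ring.
- have -> : (K' * M * N * N' = N * (K' * M * N'))%N by ring.
  have -> : (K * M * N * N' = N' * (K * M * N))%N by ring.
  rewrite !(mulrnA _ N) !(mulrnA _ N') fg fg' -!mulrnA.
  have -> : (K * (K' * M * N') = N' * M * (K * K'))%N by ring.
  have -> : (K' * (K * M * N) = N * M * (K * K'))%N by ring.
  by rewrite (mulrnA h) (mulrnA h') E.
- by apply: Sig_muln; do !apply: generatedM.
Qed.

Lemma roof_equiv_refl X Y (r : roof X Y) : roof_equiv r r.
Proof.
exists (apex r), (idm _), (idm _); split=> //.
by rewrite compm1; exact: denP.
Qed.

Lemma roof_equiv_sym X Y (r r' : roof X Y) : roof_equiv r r' -> roof_equiv r' r.
Proof.
by move=> [V [u [u' [eq_den eq_num Su]]]]; exists V, u', u; rewrite -eq_den.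
Qed.

Lemma roof_equiv_trans X Y (r' r r'' : roof X Y) :
  roof_equiv r r' -> roof_equiv r' r'' -> roof_equiv r r''.
Proof.
have [N [h rh]] := frac_ex r; have [N' [h' rh']] := frac_ex r'.
have [N'' [h'' rh'']] := frac_ex r''.
move=> /(frac_equiv rh rh')[M SM E] /(frac_equiv rh' rh'')[M' SM' E'].
apply/(frac_equiv rh rh''); exists (M * M' * N')%N.
  by do !apply: generatedM => //; case: rh'.
have -> : (N'' * (M * M' * N') = N' * M * (M' * N''))%N by ring.
have -> : (N * (M * M' * N') = N' * M' * (M * N))%N by ring.
rewrite mulrnA E [RHS]mulrnA -E' -!mulrnA; congr (_ *+ _); ring.
Qed.

Definition roof_rel X Y : rel (roof X Y) := fun r r' => `[< roof_equiv r r' >].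

Lemma roof_rel_refl X Y : reflexive (@roof_rel X Y).
Proof. by move=> r; apply/asboolP; exact: roof_equiv_refl. Qed.

Lemma roof_rel_sym X Y : symmetric (@roof_rel X Y).
Proof. by move=> r r'; apply/asboolP/asboolP; exact: roof_equiv_sym. Qed.

Lemma roof_rel_trans X Y : transitive (@roof_rel X Y).
Proof.
move=> r' r r'' /asboolP rr' /asboolP r'r''; apply/asboolP.
exact: roof_equiv_trans r'r''.
Qed.

Canonical roof_equivRel X Y := EquivRel (@roof_rel X Y)
  (@roof_rel_refl X Y) (@roof_rel_sym X Y) (@roof_rel_trans X Y).

Definition quotient_hom X Y : Type := {eq_quot (@roof_equivRel X Y)}.

HB.instance Definition _ X Y := Choice.on (quotient_hom X Y).

Definition roof_class X Y (r : roof X Y) : quotient_hom X Y :=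
  \pi_{eq_quot (@roof_equivRel X Y)} r.

Definition rep X Y (a : quotient_hom X Y) : roof X Y := repr a.

Lemma repK X Y : cancel (@rep X Y) (@roof_class X Y).
Proof. exact: reprK. Qed.

Lemma eq_class X Y (r r' : roof X Y) : roof_class r = roof_class r' <-> roof_equiv r r'.
Proof. by split=> [/eqquotP/asboolP|rr'] //; apply/eqquotP/asboolP. Qed.

(* A completion of the cospan W -f-> Y <-t- W' to a commutative square. *)
Record ore_square W W' Y (f : hom W Y) (t : hom W' Y) := OreSquare {
  ore_apex : A;
  ore_l : hom ore_apex W;
  ore_r : hom ore_apex W';
  ore_comm : f \oc ore_l = t \oc ore_r;
  ore_lP : Sig ore_l
}.

Lemma ore_ex W W' Y (f : hom W Y) (t : hom W' Y) :
  Sig t -> exists _ : ore_square f t, True.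
Proof.
move=> /iso_mod_torsionP[N [g [SN tg _]]].
have comm : f \oc (idm W *+ N) = t \oc (g \oc f).
  by rewrite compA tg !compMn compm1 comp1m.
by exists (OreSquare comm (Sig_muln W SN)).
Qed.

Definition ore W W' Y (f : hom W Y) (t : hom W' Y) (tP : Sig t) : ore_square f t :=
  sval (cid (ore_ex f tP)).

(* Up to equivalence, the operations on roofs do not depend on the choice of
   the squares. *)
Definition roof_comp X Y Z (r' : roof Y Z) (r : roof X Y) : roof X Z :=
  let sq := ore (num r) (denP r') in
  Roof (num r' \oc ore_r sq) (Sig_comp (denP r) (ore_lP sq)).

Definition roof_add X Y (r r' : roof X Y) : roof X Y :=
  let sq := ore (den r) (denP r') in
  Roof (num r \oc ore_l sq + num r' \oc ore_r sq)
       (Sig_comp (denP r) (ore_lP sq)).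

Definition roof_opp X Y (r : roof X Y) : roof X Y := Roof (- num r) (denP r).

Definition roof_of X Y (f : hom X Y) : roof X Y := Roof f (Sig1 X).

Lemma frac_comp X Y Z (r' : roof Y Z) (r : roof X Y) N' h' N h :
  frac r' N' h' -> frac r N h -> frac (roof_comp r' r) (N' * N) (h' \oc h).
Proof.
move=> [SN' hN'] [SN hN]; split; first exact: generatedM.
rewrite /roof_comp; case: (ore _ _) => P p q /= comm _.
by rewrite -compA (compA h) hN compMnl comm compMnr compA hN' compMnl mulrnA.
Qed.

Lemma frac_add X Y (r r' : roof X Y) N h N' h' :
  frac r N h -> frac r' N' h' -> frac (roof_add r r') (N * N') (h *+ N' + h' *+ N).
Proof.
move=> [SN hN] [SN' hN']; split; first exact: generatedM.
rewrite /roof_add; case: (ore _ _) => P p q /= comm _.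
rewrite compDl {2}comm !compA !compMnl hN hN' !compMnl mulrnDl -!mulrnA.
by rewrite (mulnC N').
Qed.

Lemma frac_opp X Y (r : roof X Y) N h : frac r N h -> frac (roof_opp r) N (- h).
Proof. by move=> [SN hN]; split=> //=; rewrite compNl hN mulNrn. Qed.

Lemma frac_of X Y (f : hom X Y) : frac (roof_of f) 1 f.
Proof. by split; [exact: generated1 | rewrite compm1]. Qed.

Lemma frac_eq X Y (r r' : roof X Y) N h N' h' :
  frac r N h -> frac r' N' h' -> h *+ N' = h' *+ N -> roof_class r = roof_class r'.
Proof.
move=> rh rh' E; apply/eq_class/(frac_equiv rh rh').
by exists 1%N; [exact: generated1 | rewrite !muln1].
Qed.

Definition qcomp X Y Z (b : quotient_hom Y Z) (a : quotient_hom X Y) :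
  quotient_hom X Z := roof_class (roof_comp (rep b) (rep a)).
Definition qadd X Y (a b : quotient_hom X Y) : quotient_hom X Y :=
  roof_class (roof_add (rep a) (rep b)).
Definition qopp X Y (a : quotient_hom X Y) : quotient_hom X Y :=
  roof_class (roof_opp (rep a)).

Lemma qcompE X Y Z (r' : roof Y Z) (r : roof X Y) :
  qcomp (roof_class r') (roof_class r) = roof_class (roof_comp r' r).
Proof.
rewrite /qcomp; set s' := rep _; set s := rep _.
have ss : roof_class s = roof_class r by rewrite repK.
have ss' : roof_class s' = roof_class r' by rewrite repK.
have [N [h rh]] := frac_ex r; have [N' [h' rh']] := frac_ex r'.
have [M [k sk]] := frac_ex s; have [M' [k' sk']] := frac_ex s'.
move: ss ss' => /eq_class/(frac_equiv sk rh)[L SL E].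
move=> /eq_class/(frac_equiv sk' rh')[L' SL' E'].
apply/eq_class/(frac_equiv (frac_comp sk' sk) (frac_comp rh' rh)).
exists (L' * L)%N; first exact: generatedM.
have -> : (N' * N * (L' * L) = N' * L' * (N * L))%N by ring.
have -> : (M' * M * (L' * L) = M' * L' * (M * L))%N by ring.
by rewrite mulrnA -(compMnl k') E' -(compMnr _ k) E compMnl compMnr -mulrnA mulnC.
Qed.

Lemma qaddE X Y (r r' : roof X Y) : qadd (roof_class r) (roof_class r') = roof_class (roof_add r r').
Proof.
rewrite /qadd; set s := rep (roof_class r); set s' := rep _.
have ss : roof_class s = roof_class r by rewrite repK.
have ss' : roof_class s' = roof_class r' by rewrite repK.
have [N [h rh]] := frac_ex r; have [N' [h' rh']] := frac_ex r'.
have [M [k sk]] := frac_ex s; have [M' [k' sk']] := frac_ex s'.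
move: ss ss' => /eq_class/(frac_equiv sk rh)[L SL E].
move=> /eq_class/(frac_equiv sk' rh')[L' SL' E'].
apply/eq_class/(frac_equiv (frac_add sk sk') (frac_add rh rh')).
exists (L * L')%N; first exact: generatedM.
rewrite !mulrnDl -!mulrnA; congr (_ + _).
  have -> : (M' * (N * N' * (L * L')) = N * L * (M' * N' * L'))%N by ring.
  by rewrite mulrnA E -mulrnA; congr (_ *+ _); ring.
have -> : (M * (N * N' * (L * L')) = N' * L' * (M * N * L))%N by ring.
by rewrite mulrnA E' -mulrnA; congr (_ *+ _); ring.
Qed.

Lemma qoppE X Y (r : roof X Y) : qopp (roof_class r) = roof_class (roof_opp r).
Proof.
rewrite /qopp; set s := rep _.
have ss : roof_class s = roof_class r by rewrite repK.
have [N [h rh]] := frac_ex r; have [M [k sk]] := frac_ex s.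
move: ss => /eq_class/(frac_equiv sk rh)[L SL E].
apply/eq_class/(frac_equiv (frac_opp sk) (frac_opp rh)).
by exists L; rewrite // !mulNrn E.
Qed.

Definition q0 X Y : quotient_hom X Y := roof_class (roof_of 0).
Definition q1 X : quotient_hom X X := roof_class (roof_of (idm X)).

Lemma qaddA X Y : associative (@qadd X Y).
Proof.
move=> a b c; rewrite -[a]repK -[b]repK -[c]repK !qaddE.
have [N [h ah]] := frac_ex (rep a); have [M [k bk]] := frac_ex (rep b).
have [L [l cl]] := frac_ex (rep c).
apply: (frac_eq (frac_add ah (frac_add bk cl)) (frac_add (frac_add ah bk) cl)).
rewrite !mulrnDl -!mulrnA addrA; congr (_ *+ _ + _ *+ _ + _ *+ _); ring.
Qed.

Lemma qaddC X Y : commutative (@qadd X Y).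
Proof.
move=> a b; rewrite -[a]repK -[b]repK !qaddE.
have [N [h ah]] := frac_ex (rep a); have [M [k bk]] := frac_ex (rep b).
apply: (frac_eq (frac_add ah bk) (frac_add bk ah)).
by rewrite addrC mulnC.
Qed.

Lemma qadd0 X Y : left_id (@q0 X Y) (@qadd X Y).
Proof.
move=> a; rewrite -[a]repK qaddE.
have [N [h ah]] := frac_ex (rep a).
apply: (frac_eq (frac_add (frac_of 0) ah) ah).
by rewrite mul0rn add0r mulr1n mul1n.
Qed.

Lemma qaddN X Y : left_inverse (@q0 X Y) (@qopp X Y) (@qadd X Y).
Proof.
move=> a; rewrite -[a]repK qoppE qaddE.
have [N [h ah]] := frac_ex (rep a).
apply: (frac_eq (frac_add (frac_opp ah) ah) (frac_of 0)).
by rewrite mulr1n mul0rn mulNrn addNr.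
Qed.

HB.instance Definition _ X Y := GRing.isZmodule.Build (quotient_hom X Y)
  (@qaddA X Y) (@qaddC X Y) (@qadd0 X Y) (@qaddN X Y).

Lemma qcompA X Y Z T (c : quotient_hom Z T) (b : quotient_hom Y Z)
    (a : quotient_hom X Y) : qcomp c (qcomp b a) = qcomp (qcomp c b) a.
Proof.
rewrite -[a]repK -[b]repK -[c]repK !qcompE.
have [N [h ah]] := frac_ex (rep a); have [M [k bk]] := frac_ex (rep b).
have [L [l cl]] := frac_ex (rep c).
apply: (frac_eq (frac_comp cl (frac_comp bk ah)) (frac_comp (frac_comp cl bk) ah)).
by rewrite compA mulnA.
Qed.

Lemma qcomp1m X Y (a : quotient_hom X Y) : qcomp (q1 Y) a = a.
Proof.
rewrite -[a]repK qcompE; have [N [h ah]] := frac_ex (rep a).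
apply: (frac_eq (frac_comp (frac_of _) ah) ah).
by rewrite comp1m mul1n.
Qed.

Lemma qcompm1 X Y (a : quotient_hom X Y) : qcomp a (q1 X) = a.
Proof.
rewrite -[a]repK qcompE; have [N [h ah]] := frac_ex (rep a).
apply: (frac_eq (frac_comp ah (frac_of _)) ah).
by rewrite compm1 muln1.
Qed.

Lemma qcompDl X Y Z (b c : quotient_hom Y Z) (a : quotient_hom X Y) :
  qcomp (qadd b c) a = qadd (qcomp b a) (qcomp c a).
Proof.
rewrite -[a]repK -[b]repK -[c]repK ?(qaddE, qcompE).
have [N [h ah]] := frac_ex (rep a); have [M [k bk]] := frac_ex (rep b).
have [L [l cl]] := frac_ex (rep c).
apply: (frac_eq (frac_comp (frac_add bk cl) ah)
                (frac_add (frac_comp bk ah) (frac_comp cl ah))).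
rewrite compDl !compMnl !mulrnDl -!mulrnA; congr (_ *+ _ + _ *+ _); ring.
Qed.

Lemma qcompDr X Y Z (c : quotient_hom Y Z) (a b : quotient_hom X Y) :
  qcomp c (qadd a b) = qadd (qcomp c a) (qcomp c b).
Proof.
rewrite -[a]repK -[b]repK -[c]repK ?(qaddE, qcompE).
have [N [h ah]] := frac_ex (rep a); have [M [k bk]] := frac_ex (rep b).
have [L [l cl]] := frac_ex (rep c).
apply: (frac_eq (frac_comp cl (frac_add ah bk))
                (frac_add (frac_comp cl ah) (frac_comp cl bk))).
rewrite compDr !compMnr !mulrnDl -!mulrnA; congr (_ *+ _ + _ *+ _); ring.
Qed.

Definition serre_quotient : preadditive :=
  @Preadditive A (fun X Y => quotient_hom X Y : zmodType) q1 qcomp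
    qcompA qcomp1m qcompm1 qcompDl qcompDr.

End SerreQuotient.

(* Main.v *)
(* Vanishing of a Yoneda class is tested degreewise: 0 -> Y -> E_0 -> ... -> X -> 0
   represents 0 exactly when it maps, identically on Y, to an exact chain
   Y -> D_0 -> ... -> 0 (the predicate [null]).  For each i > 0 one shows that
   Ext^i vanishes on A if and only if it vanishes on A_S and on A/A_S.

   Artinianity gives for every Y an epimorphism Y ->> D with torsion kernel onto
   an S-divisible D.  Hence an epimorphism onto a torsion object remains one on
   a torsion subobject of its source, torsion objects can be resolved inside
   A_S, and Ext_{A_S} = Ext_A on A_S; moreover Ext^i_A(X, Y) = 0 for X torsion
   and Y arbitrary as soon as Ext^i vanishes on A_S.  On the other hand chains
   and coresolutions can be transported between A and A/A_S by clearing
   denominators, so that Ext_{A/A_S} is Ext_A with <S> inverted.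

   For the converse, suppose Ext^i vanishes on A_S and A/A_S.
   Write p : X ->> D for the epimorphism above.  If m kills Y, the map m p has
   torsion kernel, so every class in Ext^i(X, Y) has the form
   (m p)^* b = m (p^* b), which is 0.  For general Y, a class in Ext^i(X, Y) is
   killed by some m in <S>, hence by m p : Y ->> D with p : Y ->> D as above; as
   the kernel K of m p is torsion, Ext^i(X, K) = 0 and the class is 0. *)
Require Import Defs.
From Stdlib Require Import Relation_Operators.
From mathcomp Require Import all_boot all_algebra.
From mathcomp Require Import boolp classical_sets.

Set Implicit Arguments.
Unset Strict Implicit.
Unset Printing Implicit Defensive.

(* [Defs] again, because [all_algebra] shadows some of its names, such as [hom]. *)
Import GRing.Theory Defs.
Local Open Scope ring_scope.
Local Open Scope quotient_scope.

(** * Abelian categories *)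

(** Monomorphisms and kernels of [op A] are by conversion epimorphisms and cokernels of [A], so dual
    lemmas are the original ones at [op A]; sections are closed early to allow this. *)
Definition op (A : preadditive) : preadditive :=
  @Preadditive A (fun X Y => hom Y X) (@idm A) (fun _ _ _ g f => f \oc g)
    (fun _ _ _ _ h g f => esym (compA f g h))
    (fun _ _ f => compm1 f) (fun _ _ f => comp1m f)
    (fun _ _ _ g g' f => compDr f g g') (fun _ _ _ g f f' => compDl f f' g).

Lemma op_zero (A : abelian) : exists Z : op A, zero_object Z.
Proof. by have [Z [Z0 Z1]] := abelian_zero A; exists Z; split. Qed.

Lemma op_biproduct (A : abelian) (X1 X2 : op A) :
  exists P (i1 : hom X1 P) (i2 : hom X2 P) (p1 : hom P X1) (p2 : hom P X2),
    is_biproduct i1 i2 p1 p2.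
Proof.
have [P [i1 [i2 [p1 [p2 [? ? ? ? ?]]]]]] := @abelian_biproduct A X1 X2.
by exists P, p1, p2, i1, i2; split.
Qed.

Definition op_abelian (A : abelian) : abelian :=
  @Abelian (op A) (op_zero A) (@op_biproduct A)
    (fun X Y => @abelian_cokernel A Y X) (fun X Y => @abelian_kernel A Y X)
    (fun X Y => @abelian_epi A Y X) (fun X Y => @abelian_mono A Y X).

Section Preadditive.
Context {A : preadditive}.
Implicit Types X Y Z W V T : A.

Lemma compBl X Y Z (g g' : hom Y Z) (f : hom X Y) :
  (g - g') \oc f = g \oc f - g' \oc f.
Proof. by rewrite compDl compNl. Qed.

Lemma compBr X Y Z (g : hom Y Z) (f f' : hom X Y) :
  g \oc (f - f') = g \oc f - g \oc f'.
Proof. by rewrite compDr compNr. Qed.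

Lemma mono0P X Y (m : hom X Y) :
  (forall W (u : hom W X), m \oc u = 0 -> u = 0) -> mono m.
Proof.
move=> m0 W u v uv; apply/eqP; rewrite -subr_eq0; apply/eqP/m0.
by rewrite compBr uv subrr.
Qed.

Lemma mono0 X Y (m : hom X Y) W (u : hom W X) : mono m -> m \oc u = 0 -> u = 0.
Proof. by move=> mm mu; apply: mm; rewrite mu comp0r. Qed.

Lemma mono1 X : mono (idm X).
Proof. by move=> W u v; rewrite !comp1m. Qed.

Lemma mono_comp X Y Z (m : hom Y Z) (m' : hom X Y) :
  mono m -> mono m' -> mono (m \oc m').
Proof. by move=> mm mm' W u v; rewrite -!compA => /mm/mm'. Qed.

Lemma kernel_mono X Y (f : hom X Y) K (k : hom K X) : is_kernel f k -> mono k.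
Proof.
move=> [fk ker] W u v uv; have [w [_ w_uniq]] := ker _ (k \oc v) ltac:(
  by rewrite compA fk comp0l).
by rewrite -(w_uniq _ uv) (w_uniq v).
Qed.

Lemma kernel_lift X Y (f : hom X Y) K (k : hom K X) W (g : hom W X) :
  is_kernel f k -> f \oc g = 0 -> exists u, k \oc u = g.
Proof. by move=> [_ ker] /ker [u [ku _]]; exists u. Qed.

Lemma kernel_intro X Y (f : hom X Y) K (k : hom K X) : mono k -> f \oc k = 0 ->
  (forall W (g : hom W X), f \oc g = 0 -> exists u, k \oc u = g) -> is_kernel f k.
Proof.
move=> mk fk ker; split=> // W g /ker [u ku]; exists u; split=> // v.
by rewrite -ku => /mk.
Qed.

End Preadditive.

Section PreadditiveDual.
Context {A : preadditive}.
Implicit Types X Y Z W V T : A.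

Lemma epi0P X Y (e : hom X Y) :
  (forall W (u : hom Y W), u \oc e = 0 -> u = 0) -> epi e.
Proof. exact: (@mono0P (op A)). Qed.

Lemma epi0 X Y (e : hom X Y) W (u : hom Y W) : epi e -> u \oc e = 0 -> u = 0.
Proof. exact: (@mono0 (op A)). Qed.

Lemma epi1 X : epi (idm X).
Proof. exact: (@mono1 (op A)). Qed.

Lemma epi_comp X Y Z (e : hom Y Z) (e' : hom X Y) : epi e -> epi e' -> epi (e \oc e').
Proof. by move=> ? ?; apply: (@mono_comp (op A)). Qed.

Lemma epi_compl X Y Z (e : hom Y Z) (e' : hom X Y) : epi (e \oc e') -> epi e.
Proof. by move=> ee W u v uv; apply: ee; rewrite !compA uv. Qed.

Lemma cokernel_epi X Y (f : hom X Y) C (c : hom Y C) : is_cokernel f c -> epi c.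
Proof. exact: (@kernel_mono (op A)). Qed.

Lemma cokernel_desc X Y (f : hom X Y) C (c : hom Y C) W (g : hom Y W) :
  is_cokernel f c -> g \oc f = 0 -> exists u, u \oc c = g.
Proof. exact: (@kernel_lift (op A)). Qed.

Lemma cokernel_intro X Y (f : hom X Y) C (c : hom Y C) : epi c -> c \oc f = 0 ->
  (forall W (g : hom Y W), g \oc f = 0 -> exists u, u \oc c = g) -> is_cokernel f c.
Proof. exact: (@kernel_intro (op A)). Qed.

End PreadditiveDual.

Section Kernels.
Context {A : abelian}.
Implicit Types X Y Z W V T : A.

Lemma mono_kernel X Y (m : hom X Y) C (c : hom Y C) :
  mono m -> is_cokernel m c -> is_kernel c m.
Proof.
move=> mm cm; have [Z [g [gm ker]]] := abelian_mono mm.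
apply: kernel_intro => //; first by case: cm.
move=> W h ch; have [u uc] := cokernel_desc cm gm.
by apply: (@kernel_lift A _ _ g); rewrite // -uc -compA ch comp0r.
Qed.

End Kernels.

(** * Images and pullbacks *)

Section Limits.
Context {A : abelian}.
Implicit Types X Y Z W V T : A.

Lemma epi_cokernel X Y (e : hom X Y) K (k : hom K X) :
  epi e -> is_kernel e k -> is_cokernel k e.
Proof. exact: (@mono_kernel (op_abelian A)). Qed.

Lemma mono_epi_lift X Y W V (m : hom X Y) (e : hom V W) (z : hom W Y) (w : hom V X) :
  mono m -> epi e -> m \oc w = z \oc e -> exists k, m \oc k = z.
Proof.
move=> mm ee wz; have [C [c cm]] := abelian_cokernel m.
apply: kernel_lift (mono_kernel mm cm) _; apply: epi0 ee _.
by rewrite -compA -wz compA (proj1 cm) comp0l.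
Qed.

(** Let [e] be the cokernel of the kernel of [f], and let [m] kill [x], with cokernel [q]. The
    epimorphism [q \oc e] is a cokernel of some [h]; [f] kills [h], hence so does [e], so [q] has a
    left inverse and [x = 0]. *)
Lemma image_factor X Y (f : hom X Y) :
  exists I (e : hom X I) (m : hom I Y), [/\ epi e, mono m & m \oc e = f].
Proof.
have [K [k kf]] := abelian_kernel f.
have [I [e ek]] := abelian_cokernel k.
have [m me] := cokernel_desc ek (proj1 kf).
have ee := cokernel_epi ek.
exists I, e, m; split=> //; apply: mono0P => W x mx.
have [Q [q qx]] := abelian_cokernel x.
have [m' m'q] := cokernel_desc qx mx.
have [V [h hqe]] := abelian_epi (epi_comp (cokernel_epi qx) ee).
have [t kt] : exists t, k \oc t = h.
  apply: kernel_lift kf _.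
  by rewrite -me -m'q -!compA (compA q) (proj1 hqe) comp0r.
have [r rqe] : exists r, r \oc (q \oc e) = e.
  by apply: cokernel_desc hqe _; rewrite -kt compA (proj1 ek) comp0l.
have rq : r \oc q = idm I by apply: ee; rewrite -compA rqe comp1m.
by rewrite -[x]comp1m -rq -compA (proj1 qx) comp0r.
Qed.

(** The kernel of [f \oc p1 - g \oc p2] on the biproduct. If [f] is epi, so is this difference,
    hence it is the cokernel of [k]; a map [v \oc p2] killing [k] factors through it by some [w],
    and restriction to the first summand gives [w \oc f = 0]. *)
Lemma pullback_ex X1 X2 Y (f : hom X1 Y) (g : hom X2 Y) :
  exists P (p1 : hom P X1) (p2 : hom P X2),
    [/\ f \oc p1 = g \oc p2,
        forall W (u1 : hom W X1) (u2 : hom W X2), f \oc u1 = g \oc u2 ->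
          exists u, p1 \oc u = u1 /\ p2 \oc u = u2,
        forall W (u v : hom W P), p1 \oc u = p1 \oc v -> p2 \oc u = p2 \oc v -> u = v,
        epi f -> epi p2 & epi g -> epi p1].
Proof.
have [B [i1 [i2 [p1 [p2 [p11 p22 p21 p12 pE]]]]]] := abelian_biproduct X1 X2.
have [P [k kf]] := abelian_kernel (f \oc p1 - g \oc p2).
have fi1 : (f \oc p1 - g \oc p2) \oc i1 = f.
  by rewrite compBl -!compA p11 p21 comp0r compm1 subr0.
have fi2 : (f \oc p1 - g \oc p2) \oc i2 = - g.
  by rewrite compBl -!compA p22 p12 comp0r compm1 sub0r.
exists P, (p1 \oc k), (p2 \oc k); split.
- by apply/eqP; rewrite -subr_eq0 !compA -compBl (proj1 kf).
- move=> W u1 u2 E.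
  have [u ku] : exists u, k \oc u = i1 \oc u1 + i2 \oc u2.
    apply: kernel_lift kf _; rewrite compDr !compA fi1 fi2 compNl E.
    exact: subrr.
  exists u; rewrite -!compA ku !compDr !compA p11 p21 p12 p22 !comp0l !comp1m.
  by rewrite addr0 add0r.
- move=> W u v; rewrite -!compA => E1 E2; apply: (kernel_mono kf).
  by rewrite -[k \oc u]comp1m -[k \oc v]comp1m -pE !compDl -!compA E1 E2.
- move=> ef; apply: epi0P => W v vk.
  have ee : epi (f \oc p1 - g \oc p2) by apply: (@epi_compl _ _ _ _ _ i1); rewrite fi1.
  have [w wE] : exists w, w \oc (f \oc p1 - g \oc p2) = v \oc p2.
    by apply: cokernel_desc (epi_cokernel ee kf) _; rewrite -compA.
  have w0 : w = 0 by apply: (epi0 ef); rewrite -fi1 compA wE -compA p21 comp0r.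
  by rewrite -[v]compm1 -p22 compA -wE w0 !comp0l.
- move=> eg; apply: epi0P => W v vk.
  have ee : epi (f \oc p1 - g \oc p2).
    apply: (@epi_compl _ _ _ _ _ i2); rewrite fi2; apply: epi0P => V u.
    by rewrite compNr => /eqP; rewrite oppr_eq0 => /eqP; apply: epi0.
  have [w wE] : exists w, w \oc (f \oc p1 - g \oc p2) = v \oc p1.
    by apply: cokernel_desc (epi_cokernel ee kf) _; rewrite -compA.
  have w0 : w = 0.
    apply: (epi0 eg); apply: oppr_inj.
    by rewrite -compNr -fi2 compA wE -compA p12 comp0r oppr0.
  by rewrite -[v]compm1 -p11 compA -wE w0 !comp0l.
Qed.

End Limits.

(** * Exact sequences and pushouts *)

Section Exactness.
Context {A : abelian}.
Implicit Types X Y Z W V T : A.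

Lemma pushout_ex X1 X2 Y (f : hom Y X1) (g : hom Y X2) :
  exists P (i1 : hom X1 P) (i2 : hom X2 P),
    [/\ i1 \oc f = i2 \oc g,
        forall W (u1 : hom X1 W) (u2 : hom X2 W), u1 \oc f = u2 \oc g ->
          exists u, u \oc i1 = u1 /\ u \oc i2 = u2,
        forall W (u v : hom P W), u \oc i1 = v \oc i1 -> u \oc i2 = v \oc i2 -> u = v,
        mono f -> mono i2 & mono g -> mono i1].
Proof. exact: (@pullback_ex (op_abelian A)). Qed.

(** For left to right: if [v] kills [f'], then [f] factors through the kernel of [v], a subobject of
    [m]. The cokernel [c'] of that subobject factors through [c], so it kills [m]; the subobject is
    all of [m] and [v = 0]. *)
Lemma exactP X Y Z (f : hom X Y) (g : hom Y Z) :
  exact f g <-> exists K (k : hom K Y) (f' : hom X K),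
    [/\ is_kernel g k, k \oc f' = f & epi f'].
Proof.
split=> [[I [m [[C [c [cf mc]]] gm]]]|[K [k [f' [kg kf' ef']]]]].
  have [f' mf'] := kernel_lift mc (proj1 cf).
  exists I, m, f'; split=> //; apply: epi0P => W v vf'.
  have [K [k kv]] := abelian_kernel v.
  have [f'' kf''] := kernel_lift kv vf'.
  have mmk : mono (m \oc k) by apply: mono_comp (kernel_mono mc) (kernel_mono kv).
  have [C' [c' c'mk]] := abelian_cokernel (m \oc k).
  have [t tc] : exists t, t \oc c = c'.
    apply: cokernel_desc cf _.
    by rewrite -mf' -kf'' compA compA -(compA c') (proj1 c'mk) comp0l.
  have [s ms] : exists s, (m \oc k) \oc s = m.
    apply: kernel_lift (mono_kernel mmk c'mk) _.
    by rewrite -tc -compA (proj1 mc) comp0r.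
  have ks : k \oc s = idm I.
    by apply: (kernel_mono mc); rewrite compA ms compm1.
  by rewrite -[v]compm1 -ks compA (proj1 kv) comp0l.
have [C [c ck]] := abelian_cokernel k.
exists K, k; split=> //; exists C, c; split; last first.
  exact: mono_kernel (kernel_mono kg) ck.
apply: cokernel_intro; first exact: cokernel_epi ck.
  by rewrite -kf' compA (proj1 ck) comp0l.
move=> W h hf; apply: cokernel_desc ck _; apply: epi0 ef' _.
by rewrite -compA kf'.
Qed.

Lemma exact0 X Y Z (f : hom X Y) (g : hom Y Z) : exact f g -> g \oc f = 0.
Proof.
by move=> /exactP[K [k [f' [kg <- _]]]]; rewrite compA (proj1 kg) comp0l.
Qed.

(** Diagram chase with a generalized element [w]: a cycle becomes a boundary after an epimorphism.
    The converse is [exact_intro]. *)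
Lemma exact_lift X Y Z (f : hom X Y) (g : hom Y Z) W (w : hom W Y) :
  exact f g -> g \oc w = 0 ->
  exists W' (p : hom W' W) (w' : hom W' X), epi p /\ f \oc w' = w \oc p.
Proof.
move=> /exactP[K [k [f' [kg <- ef']]]] /(kernel_lift kg)[u ku].
have [P [p1 [p2 [E _ _ ep _]]]] := pullback_ex f' u.
by exists P, p2, p1; split; [exact: ep | rewrite -compA E compA ku].
Qed.

Lemma exact_intro X Y Z (f : hom X Y) (g : hom Y Z) : g \oc f = 0 ->
  (forall W (w : hom W Y), g \oc w = 0 ->
    exists W' (p : hom W' W) (w' : hom W' X), epi p /\ f \oc w' = w \oc p) ->
  exact f g.
Proof.
move=> gf lift; apply/exactP; have [K [k kg]] := abelian_kernel g.
have [f' kf'] := kernel_lift kg gf.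
exists K, k, f'; split=> //.
have [W [p [w [ep fw]]]] := lift _ _ (proj1 kg).
apply: (@epi_compl _ _ _ _ _ w).
by have -> : f' \oc w = p by apply: (kernel_mono kg); rewrite compA kf'.
Qed.

Lemma exact_kernel X Y Z (f : hom X Y) (g : hom Y Z) : is_kernel g f -> exact f g.
Proof.
move=> fg; apply/exactP; exists X, f, (idm X).
by split; rewrite ?compm1 //; exact: epi1.
Qed.

Lemma exact_cokernel X Y Z (f : hom X Y) (g : hom Y Z) : is_cokernel f g -> exact f g.
Proof.
move=> fg; have [K [k kg]] := abelian_kernel g.
by exists K, k; split=> //; exists Z, g.
Qed.

Lemma exact_epi_cokernel X Y Z (f : hom X Y) (g : hom Y Z) :
  exact f g -> epi g -> is_cokernel f g.
Proof.
move=> /exactP[K [k [f' [kg <- ef']]]] eg.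
have gk := epi_cokernel eg kg.
apply: cokernel_intro => //; first by rewrite compA (proj1 kg) comp0l.
by move=> W h hk; apply: cokernel_desc gk _; apply: epi0 ef' _; rewrite -compA.
Qed.

Lemma exact_epi X Y Z W (p : hom W X) (f : hom X Y) (g : hom Y Z) :
  epi p -> exact f g -> exact (f \oc p) g.
Proof.
move=> ep /exactP[K [k [f' [kg <- ef']]]]; apply/exactP; exists K, k, (f' \oc p).
by split; rewrite ?compA //; exact: epi_comp.
Qed.

Lemma exact_mono X Y Z T (f : hom X Y) (g : hom Y Z) (m : hom Z T) :
  mono m -> exact f g -> exact f (m \oc g).
Proof.
move=> mm fg; apply: exact_intro; first by rewrite -compA (exact0 fg) comp0r.
by move=> W w; rewrite -compA => /(mono0 mm); exact: exact_lift.
Qed.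

Lemma exact_mono_cancel X Y Z T (f : hom X Y) (g : hom Y Z) (m : hom Z T) :
  exact f (m \oc g) -> g \oc f = 0 -> exact f g.
Proof.
move=> fg gf; apply: exact_intro => // W w gw; apply: exact_lift fg _.
by rewrite -compA gw comp0r.
Qed.

Lemma exact_through X X' Y Z (f : hom X X') (g : hom X' Y) (h : hom Y Z) :
  exact (g \oc f) h -> h \oc g = 0 -> exact g h.
Proof.
move=> gfh hg; apply: exact_intro => // W w hw.
have [W' [p [w' [ep E]]]] := exact_lift gfh hw.
by exists W', p, (f \oc w'); rewrite compA.
Qed.

Lemma mono_exact W X Y (m : hom X Y) : mono m <-> exact (0 : hom W X) m.
Proof.
split=> [mm|mm].
  apply: exact_intro => [|V w /(mono0 mm)->]; first exact: comp0r.
  by exists V, (idm V), 0; split; [exact: epi1 | rewrite !comp0r comp0l].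
apply: mono0P => V u mu; have [V' [p [w [ep]]]] := exact_lift mm mu.
by rewrite comp0l => /esym; exact: epi0.
Qed.

Lemma exact_epi0 X Y Z (f : hom X Y) : epi f -> exact f (0 : hom Y Z).
Proof.
move=> ef; apply: exact_intro => [|W w _]; first exact: comp0l.
have [P [p1 [p2 [PE _ _ ep _]]]] := pullback_ex f w.
by exists P, p2, p1; split; first exact: ep.
Qed.

(* [i2] is mono although [g] need not be, because [z] kills the kernel of [g]. *)
Lemma exact_pushout V Y Z D (f : hom V Y) (g : hom Y Z) (z : hom Y D) :
  exact f g -> z \oc f = 0 ->
  exists P (i1 : hom Z P) (i2 : hom D P),
    [/\ i1 \oc g = i2 \oc z, mono i2,
        forall W (u1 : hom Z W) (u2 : hom D W), u1 \oc g = u2 \oc z ->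
          exists u, u \oc i1 = u1 /\ u \oc i2 = u2 &
        forall W (u v : hom P W), u \oc i1 = v \oc i1 -> u \oc i2 = v \oc i2 -> u = v].
Proof.
move=> fg zf; have [I [e [m [ee mm me]]]] := image_factor g.
have ef : e \oc f = 0.
  by apply: (mono0 mm); rewrite compA me (exact0 fg).
have fe : exact f e by apply: (@exact_mono_cancel _ _ _ _ _ _ m); rewrite ?me.
have [z' z'e] := cokernel_desc (exact_epi_cokernel fe ee) zf.
have [P [i1 [i2 [E univ joint mi _]]]] := pushout_ex m z'.
exists P, i1, i2; split; first by rewrite -me compA E -compA z'e.
  exact: mi.
  move=> W u1 u2 u12; apply: univ; apply: ee.
  by rewrite -!compA me z'e.
exact: joint.
Qed.

End Exactness.

(** * Ladders and exact chains *)

Section Ladders.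
Context {A : preadditive}.
Implicit Types X Y Z W V T E : A.

Definition ccons n X Y E (e : hom Y E) (c : chain n E X) : chain n.+1 Y X :=
  existT (fun E => (hom Y E * chain n E X)%type) E (e, c).

(* [chain_map] with [x] in place of the identity at the end. *)
Fixpoint ladder n Y Y' X X' (u : hom Y Y') (x : hom X X') :
    chain n Y X -> chain n Y' X' -> Prop :=
  match n with
  | 0 => fun g g' => x \oc g = g' \oc u
  | m.+1 => fun c c' =>
      exists2 v : hom (projT1 c) (projT1 c'),
        v \oc (projT2 c).1 = (projT2 c').1 \oc u &
        ladder v x (projT2 c).2 (projT2 c').2
  end.

Definition precomp n Y Y' X (p : hom Y' Y) : chain n Y X -> chain n Y' X :=
  match n with
  | 0 => fun g => g \oc p
  | m.+1 => fun c => ccons ((projT2 c).1 \oc p) (projT2 c).2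
  end.

Lemma ladder_chain_map n Y Y' X (u : hom Y Y') (c : chain n Y X) (c' : chain n Y' X) :
  chain_map u c c' <-> ladder u (idm X) c c'.
Proof.
elim: n Y Y' u c c' => [|n IHn] Y Y' u c c' /=; first by rewrite comp1m.
by split=> -[v E /IHn cc']; exists v.
Qed.

Lemma ladder_comp n Y1 Y2 Y3 X1 X2 X3 (u : hom Y1 Y2) (u' : hom Y2 Y3)
    (x : hom X1 X2) (x' : hom X2 X3) (c1 : chain n Y1 X1) (c2 : chain n Y2 X2)
    (c3 : chain n Y3 X3) :
  ladder u x c1 c2 -> ladder u' x' c2 c3 -> ladder (u' \oc u) (x' \oc x) c1 c3.
Proof.
elim: n Y1 Y2 Y3 u u' c1 c2 c3 => [|n IHn] Y1 Y2 Y3 u u' c1 c2 c3 /=.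
  by move=> E E'; rewrite -compA E !compA E'.
move=> [v E l] [v' E' l']; exists (v' \oc v); last exact: IHn l l'.
by rewrite -compA E !compA E'.
Qed.

Lemma ladder_muln n Y Y' X X' (u : hom Y Y') (x : hom X X') (c : chain n Y X)
    (c' : chain n Y' X') m :
  ladder u x c c' -> ladder (u *+ m) (x *+ m) c c'.
Proof.
elim: n Y Y' u c c' => [|n IHn] Y Y' u c c' /=; first by rewrite !compMn => ->.
by move=> [v E l]; exists (v *+ m); [rewrite !compMn E | exact: IHn].
Qed.

Lemma ladder_id n Y X (c : chain n Y X) : ladder (idm Y) (idm X) c c.
Proof.
elim: n Y c => [|n IHn] Y c /=; first by rewrite comp1m compm1.
by exists (idm _); rewrite ?comp1m ?compm1.
Qed.

Lemma ladder_precomp n Y Y' X (p : hom Y' Y) (c : chain n Y X) :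
  ladder p (idm X) (precomp p c) c.
Proof.
case: n c => [|n] c /=; first by rewrite comp1m.
by exists (idm _); [rewrite comp1m | exact: ladder_id].
Qed.

Lemma ladder_precompl n Y Y' Y2 X X2 (p : hom Y' Y) (u : hom Y Y2) (x : hom X X2)
    (c : chain n Y X) (c2 : chain n Y2 X2) :
  ladder u x c c2 -> ladder (u \oc p) x (precomp p c) c2.
Proof. by move=> /(ladder_comp (ladder_precomp p c)); rewrite compm1. Qed.

Lemma ladder_precompr n Y Y' Y2 X X2 (p : hom Y2 Y') (u : hom Y Y2) (x : hom X X2)
    (c : chain n Y X) (c2 : chain n Y' X2) :
  ladder u x c (precomp p c2) <-> ladder (p \oc u) x c c2.
Proof.
case: n c c2 => [|n] c c2 /=; first by rewrite compA.
by split=> -[v E l]; exists v; rewrite // E compA.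
Qed.

End Ladders.

Section ExactChains.
Context {A : abelian}.
Implicit Types X Y Z W V T E : A.

(** A zero map in front makes [exact_chain] an instance of [exact_from], which is suited to
    induction. *)
Lemma exact_chainP n W Y X (c : chain n.+1 Y X) :
  exact_chain c <-> exact_from (0 : hom W Y) c.
Proof. by split=> -[/= /(mono_exact W)]. Qed.

Lemma exact_from_epi n W V Y X (p : hom W V) (f : hom V Y) (c : chain n Y X) :
  epi p -> exact_from f c -> exact_from (f \oc p) c.
Proof. by case: n c => [|n] c ep /= [/(exact_epi ep)]. Qed.

Lemma exact_from_precomp n V Y Y' X (f : hom V Y) (p : hom Y' Y) (c : chain n Y X) :
  epi p -> exact_from f c -> exists V' (f' : hom V' Y'),
    mono f' /\ exact_from f' (precomp p c).
Proof.
case: n c => [|n] c ep /= [fe ec].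
  have [K [k kg]] := abelian_kernel (c \oc p).
  exists K, k; split; first exact: kernel_mono kg.
  by split; [exact: exact_kernel | exact: epi_comp].
have [K [k kg]] := abelian_kernel ((projT2 c).1 \oc p).
exists K, k; split; first exact: kernel_mono kg.
by split; [exact: exact_kernel | exact: exact_from_epi].
Qed.

Lemma exact_from_iso n V Y Y' X (f : hom V Y) (v : hom Y Y')
    (v' : hom Y' Y) (c : chain n Y X) :
  v' \oc v = idm Y -> v \oc v' = idm Y' -> exact_from f c ->
  exact_from (v \oc f) (precomp v' c).
Proof.
move=> v'v vv'.
have ev' : epi v' by apply: (@epi_compl _ _ _ _ _ v); rewrite v'v; exact: epi1.
have ex Z (g : hom Y Z) : exact f g -> exact (v \oc f) (g \oc v').
  move=> fg; apply: exact_intro.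
    by rewrite -compA (compA v') v'v comp1m (exact0 fg).
  move=> W w; rewrite -compA => /(exact_lift fg)[W' [p [w' [ep E]]]].
  by exists W', p, w'; rewrite -compA E !compA vv' comp1m.
case: n c => [|n] c /= [/ex fc ec]; split=> //; first exact: epi_comp.
exact: exact_from_epi.
Qed.

Lemma ladder_lift n V V' Y Y' X X' (f : hom V Y) (f' : hom V' Y') (u : hom Y Y')
    (x : hom X X') (c : chain n Y X) (c' : chain n Y' X') :
  exact_from f c -> exact_from f' c' -> ladder u x c c' ->
  exists W (p : hom W V) (w : hom W V'), epi p /\ f' \oc w = u \oc f \oc p.
Proof.
case: n c c' => [|n] c c' /= [fc _] [fc' _].
  move=> E; apply: exact_lift fc' _.
  by rewrite compA -E -compA (exact0 fc) comp0r.
move=> [v E _]; apply: exact_lift fc' _.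
by rewrite compA -E -compA (exact0 fc) comp0r.
Qed.

(** The first map of [c'] kills [f']. This is how cocycles get corrected by coboundaries. *)
Lemma ladder_subr n V' Y Y' X X' (f' : hom V' Y') (u : hom Y Y') (t : hom Y V')
    (x : hom X X') (c : chain n Y X) (c' : chain n Y' X') :
  exact_from f' c' -> ladder u x c c' -> ladder (u - f' \oc t) x c c'.
Proof.
case: n c c' => [|n] c c' /= [/exact0 fc' _].
  by move=> ->; rewrite compBr compA fc' comp0l subr0.
by move=> [v E l]; exists v; rewrite // compBr compA fc' comp0l subr0.
Qed.

(** Represents [x^*]: only the last middle term changes, to its pullback along [x], whose universal
    property gives the third clause. *)
Lemma chain_pullback n V Y X X' (f : hom V Y) (x : hom X X') (c' : chain n.+1 Y X') :
  exact_from f c' ->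
  exists c : chain n.+1 Y X, [/\ exact_from f c, ladder (idm Y) x c c' &
    forall V0 Y0 (f0 : hom V0 Y0) (u : hom Y0 Y) (c0 : chain n.+1 Y0 X),
      exact_from f0 c0 -> ladder u x c0 c' -> ladder u (idm X) c0 c].
Proof.
elim: n V Y f c' => [|n IHn] V Y f [E [e c']] /= [fe].
  move=> [eg epig]; have [P [p1 [p2 [pE univ joint ep _]]]] := pullback_ex c' x.
  have [e' [e1 e2]] : exists e', p1 \oc e' = e /\ p2 \oc e' = 0.
    by apply: univ; rewrite (exact0 eg) comp0r.
  exists (ccons (n := 0) e' p2); split=> /=.
  - split; last split; last exact: ep.
      apply: (@exact_mono_cancel _ _ _ _ _ _ _ p1); rewrite ?e1 //.
      by apply: joint; rewrite comp0r compA ?e1 ?e2 ?comp0l ?(exact0 fe).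
    apply: exact_intro => // W w p2w.
    have [W' [p [w' [epip E']]]] : exists W' (p : hom W' W) w',
        epi p /\ e \oc w' = (p1 \oc w) \oc p.
      by apply: exact_lift eg _; rewrite compA pE -compA p2w comp0r.
    exists W', p, w'; split=> //; apply: joint; first by rewrite compA e1 E' compA.
    by rewrite !compA e2 p2w !comp0l.
  - by exists p1; rewrite ?compm1 ?pE.
  - move=> V0 Y0 f0 u [E0 [e0 g0]] /= [_ [/exact0 ge0 _]] [v ve xg].
    have [w [w1 w2]] := univ _ _ _ (esym xg).
    exists w; last by rewrite comp1m w2.
    by apply: joint; rewrite !compA ?w1 ?e1 ?w2 ?e2 ?ge0 ?comp0l ?ve.
move=> ex; have [c [cex cc' univ]] := IHn _ _ _ _ ex.
exists (ccons e c); split=> //=.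
  by exists (idm E); [rewrite comp1m compm1 | exact: cc'].

move=> V0 Y0 f0 u [E0 [e0 c0]] /= [_ ex0] [v ve l].
by exists v; last exact: univ ex0 l.
Qed.
Lemma exact_from_through n V V' W Y X (g : hom W Y) (i : hom V W) (i' : hom V' W)
    (c : chain n Y X) :
  (forall T (u v : hom W T), u \oc i = v \oc i -> u \oc i' = v \oc i' -> u = v) ->
  g \oc i' = 0 -> exact_from (g \oc i) c -> exact_from g c.
Proof.
move=> joint gi'; case: n c => [|n] c /= [ex ?]; split=> //;
  apply: exact_through (ex) _; apply: joint;
  by rewrite ?comp0l -compA ?gi' ?comp0r // (exact0 ex).
Qed.

(** Represents [y_*]: only the first middle term changes, to a pushout [P]. Since [y] kills [f],
    [i2] is mono even when the first map of [c] is not. *)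
Lemma chain_pushout n V Y Y' X (f : hom V Y) (y : hom Y Y') (c : chain n.+1 Y X) :
  exact_from f c -> y \oc f = 0 ->
  exists c' : chain n.+1 Y' X, exact_chain c' /\ ladder y (idm X) c c'.
Proof.
case: c => E [e c] /= [fe ex] yf.
have [P [i1 [i2 [PE mi2 univ joint]]]] := exact_pushout fe yf.
(* [g'] extends [g] by zero; its epi part [k'] is a cokernel of [i2] as [k] is one of [e]. *)
have desc T (g : hom E T) : exact e g -> exists g' : hom P T,
    [/\ g' \oc i1 = g, g' \oc i2 = 0 & exact i2 g'].
  move=> eg; have [g' [g'1 g'2]] : exists g', g' \oc i1 = g /\ g' \oc i2 = 0.
    by apply: univ; rewrite (exact0 eg) comp0l.
  exists g'; split=> //; have [I [k [m [ek mm mk]]]] := image_factor g.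
  have ke : k \oc e = 0.
    by apply: (mono0 mm); rewrite compA mk (exact0 eg).
  have exk : exact e k by apply: (@exact_mono_cancel _ _ _ _ _ _ _ m); rewrite ?mk.
  have [k' [k'1 k'2]] : exists k', k' \oc i1 = k /\ k' \oc i2 = 0.
    by apply: univ; rewrite ke comp0l.
  have -> : g' = m \oc k'.
    by apply: joint; rewrite -compA ?k'1 ?k'2 ?g'1 ?g'2 ?comp0r.
  apply: exact_mono => //; apply/exact_kernel/mono_kernel => //.
  apply: cokernel_intro => //.
    by apply: (@epi_compl _ _ _ _ _ i1); rewrite k'1.
  move=> W h hi2.
  have [h' h'k] : exists h', h' \oc k = h \oc i1.
    apply: cokernel_desc (exact_epi_cokernel exk ek) _.
    by rewrite -compA PE compA hi2 comp0l.
  by exists h'; apply: joint; rewrite -compA ?k'1 ?k'2 ?hi2 ?comp0r.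
case: n c ex => [|n] c /= [eg epi_g].
  have [g' [g'1 g'2 ex']] := desc _ _ eg.
  exists (ccons (n := 0) i2 g'); split; last by exists i1; rewrite ?comp1m ?g'1.
  by split=> //; split=> //; apply: (@epi_compl _ _ _ _ _ i1); rewrite g'1.
have [g' [g'1 g'2 ex']] := desc _ _ eg.
exists (ccons (n := n.+1) i2 (ccons g' (projT2 c).2)); split; last first.
  exists i1 => //; exists (idm _); last exact: ladder_id.
  by rewrite comp1m.
split=> //; split=> //=.
by apply: (exact_from_through joint g'2); rewrite g'1.
Qed.

End ExactChains.

(** * Vanishing of Yoneda classes *)

(* [null x y c] says that the Yoneda class [x^* y_* c] vanishes: the chain can
   be mapped, over [y], to a coresolution of [Y'] whose last term absorbs [x].
   For [n = 0] the chain is a quotient map [g], and [y] descends to [h]. *)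
Fixpoint null (A : preadditive) n (Y X X' Y' : A) (x : hom X' X) (y : hom Y Y') :
    chain n Y X -> Prop :=
  match n with
  | 0 => fun g => exists2 h, h \oc g = y & h \oc x = 0
  | m.+1 => fun c => exists D Q (j : hom Y' D) (q : hom D Q) (u : hom (projT1 c) D),
      [/\ mono j, is_cokernel j q, u \oc (projT2 c).1 = j \oc y &
          null x (q \oc u) (projT2 c).2]
  end.

Section Null.
Context {A : abelian}.
Implicit Types X Y Z W V T E : A.

Lemma cokernel_zero X Z : zero_object Z -> is_cokernel (idm X) (0 : hom X Z).
Proof.
move=> [Z0 Z1]; apply: cokernel_intro; last 1 first.
- by move=> W g; rewrite compm1 => ->; exists 0; rewrite comp0r.
- by move=> W u v _; rewrite (Z1 _ u) (Z1 _ v).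
- by rewrite comp0l.
Qed.

Lemma null0 n Y X X' Y' (x : hom X' X) (c : chain n Y X) : null x (0 : hom Y Y') c.
Proof.
elim: n Y Y' c => [|n IHn] Y Y' c /=; first by exists 0; rewrite comp0l.
have [Z Z0] := abelian_zero A.
exists Y', Z, (idm Y'), 0, 0; rewrite !comp0l comp0r; split => //.
- exact: mono1.
- exact: cokernel_zero.
Qed.

(** The coresolution is pushed out along [w]; the induced map of cokernels takes the place of [w] at
    the next term. *)
Lemma null_post n Y X X' Y' Y'' (x : hom X' X) (y : hom Y Y') (w : hom Y' Y'')
  (c : chain n Y X) : null x y c -> null x (w \oc y) c.
Proof.
elim: n Y Y' Y'' y w c => [|n IHn] Y Y' Y'' y w c /=.
  by move=> [h hc hx]; exists (w \oc h); rewrite -compA ?hc ?hx ?comp0r.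
move=> [D [Q [j [q [u [mj qj uj nu]]]]]].
have [P [i1 [i2 [PE _ _ mi _]]]] := pushout_ex j w.
have [Q' [q' qi]] := abelian_cokernel i2.
have [z zq] : exists z, z \oc q = q' \oc i1.
  by apply: cokernel_desc qj _; rewrite -compA PE compA (proj1 qi) comp0l.
exists P, Q', i2, q', (i1 \oc u); split=> //; first exact: mi.
  by rewrite -compA uj !compA PE.
by rewrite compA -zq -compA; exact: IHn.
Qed.

(** Both coresolutions map to one that starts with the pushout of [j] and [j'], where the maps can
    be added. *)
Lemma null_add n Y X X' Y' (x : hom X' X) (y y' : hom Y Y') (c : chain n Y X) :
  null x y c -> null x y' c -> null x (y + y') c.
Proof.
elim: n Y Y' y y' c => [|n IHn] Y Y' y y' c /=.
  move=> [h hc hx] [h' hc' hx']; exists (h + h'); first by rewrite compDl hc hc'.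
  by rewrite compDl hx hx' addr0.
move=> [D [Q [j [q [u [mj qj uj nu]]]]]] [D' [Q' [j' [q' [u' [mj' qj' uj' nu']]]]]].
have [P [i1 [i2 [PE _ _ mi _]]]] := pushout_ex j j'.
have mP : mono (i2 \oc j') by apply: mono_comp mj'; exact: mi.
have [R [r rP]] := abelian_cokernel (i2 \oc j').
have [z zq] : exists z, z \oc q = r \oc i1.
  by apply: cokernel_desc qj _; rewrite -compA PE (proj1 rP).
have [z' zq'] : exists z, z \oc q' = r \oc i2.
  by apply: cokernel_desc qj' _; rewrite -compA (proj1 rP).
exists P, R, (i2 \oc j'), r, (i1 \oc u + i2 \oc u'); split=> //.
  by rewrite compDl compDr -!compA uj uj' !compA PE.
rewrite compDr !compA -zq -zq' -!compA.
by apply: IHn; apply: null_post.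
Qed.

Lemma null_ladder n Y Y' X X' X1 X1' Y'' (x : hom X1 X) (x' : hom X1' X') (w : hom X1 X1')
    (v : hom Y Y') (z : hom X X') (y : hom Y' Y'') (c : chain n Y X) (c' : chain n Y' X') :
  ladder v z c c' -> z \oc x = x' \oc w -> null x' y c' -> null x (y \oc v) c.
Proof.
move=> l zx; elim: n Y Y' Y'' v y c c' l => [|n IHn] Y Y' Y'' v y c c' /=.
  move=> E [h hc hx]; exists (h \oc z); first by rewrite -compA E compA hc.
  by rewrite -compA zx compA hx comp0l.
move=> [t tE l] [D [Q [j [q [u [mj qj uj nu]]]]]].
exists D, Q, j, q, (u \oc t); split=> //; first by rewrite -compA tE !compA uj.
by rewrite compA; exact: IHn l nu.
Qed.

Lemma null_pull n Y Y' X X' Y'' (v : hom Y Y') (z : hom X X') (y : hom Y' Y'')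
    (c : chain n Y X) (c' : chain n Y' X') :
  ladder v z c c' -> null (idm X') y c' -> null (idm X) (y \oc v) c.
Proof. by move=> l; apply: (null_ladder (w := z)) l _; rewrite compm1 comp1m. Qed.

(** Effaceability: in the pushout along the first map of [c], [i2 \oc y] extends to the first middle
    term, so the coresolution can be an identity followed by 0. *)
Lemma null_efface n V Y X X' Y' (f : hom V Y) (x : hom X' X) (y : hom Y Y')
    (c : chain n.+1 Y X) : exact_from f c -> y \oc f = 0 ->
  exists D (k : hom Y' D), mono k /\ null x (k \oc y) c.
Proof.
move=> /= [fe _] yf; have [P [i1 [i2 [PE mi _ _]]]] := exact_pushout fe yf.
exists P, i2; split=> //; have [Z Z0] := abelian_zero A.
exists P, Z, (idm P), 0, i1; split; first exact: mono1.
- exact: cokernel_zero.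
- by rewrite comp1m.
- by rewrite comp0l; exact: null0.
Qed.

(** Vanishing moves forward along a ladder, so it depends on the class only. The coresolution for
    [c] is pushed out to one for [c']; its maps may disagree with the ladder by a defect [s], which
    a further embedding [k] removes. *)
Lemma null_push n V V' Y Y' X X' Y'' (f : hom V Y) (f' : hom V' Y') (u : hom Y Y')
    (x : hom X X') (y : hom Y' Y'') (c : chain n Y X) (c' : chain n Y' X') :
  exact_from f c -> exact_from f' c' -> ladder u x c c' -> mono x ->
  y \oc f' = 0 -> null (idm X) (y \oc u) c -> null x y c'.
Proof.
move=> ex ex' l mx; elim: n V V' Y Y' Y'' f f' u y c c' ex ex' l
    => [|n IHn] V V' Y Y' Y'' f f' u y c c' /=.
  move=> [fc ec] [fc' ec'] E yf [h hc]; rewrite compm1 => h0.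
  have [h' hc'] := cokernel_desc (exact_epi_cokernel fc' ec') yf.
  exists h' => //; apply: epi0 ec _.
  by rewrite -compA E compA hc' -hc h0 comp0l.
case: c c' => [E [e c]] [E' [e' c']] /= [fe ex] [fe' ex'] [v ve l] yf.
move=> [D [Q [j [q [t [mj qj tj nu]]]]]].
have jyf : (j \oc y) \oc f' = 0 by rewrite -compA yf comp0r.
have [P [i1 [i2 [PE mi _ _]]]] := exact_pushout fe' jyf.
(* The two maps agree on [Y], so [s] kills [e]. *)
pose s := i1 \oc v - i2 \oc t.
have se : s \oc e = 0.
  by rewrite compBl -!compA ve tj !compA PE !compA subrr.
have i1v : i1 \oc v = i2 \oc t + s by rewrite addrC subrK.
suff [P' [k [i1' [mk ei1 ni]]]] : exists P' (k : hom P P') (i1' : hom E' P'),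
    [/\ mono k, i1' \oc e' = k \oc (i1 \oc e') &
        forall R (r : hom P' R), is_cokernel (k \oc (i2 \oc j)) r ->
          null x (r \oc i1') c'].
  have mkj : mono (k \oc (i2 \oc j)) by do !apply: mono_comp.
  have [R [r rk]] := abelian_cokernel (k \oc (i2 \oc j)).
  exists P', R, (k \oc (i2 \oc j)), r, i1'; split=> //; last exact: ni.
  by rewrite ei1 PE !compA.
case: n {IHn} c c' nu ex ex' l (IHn) => [|n] c c' nu ex ex' l IHn.
  have [ec epi_c] := ex; have [ec' epi_c'] := ex'.
  (* Here [s] comes from [s'] on [X], which extends to [i3] on [X'] because [x] is mono; subtracting
     [i3 \oc c'] cancels the defect. *)
  have [s' s'c] := cokernel_desc (exact_epi_cokernel ec epi_c) se.
  have [P' [i3 [k [P'E _ _ mk _]]]] := pushout_ex x s'.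
  have {}mk : mono k by apply: mk.
  exists P', k, (k \oc i1 - i3 \oc c'); split=> //.
    by rewrite compBl -!compA (exact0 ec') comp0r subr0.
  move=> R r rk.
  have [h hc'] : exists h, h \oc c' = r \oc (k \oc i1 - i3 \oc c').
    apply: cokernel_desc (exact_epi_cokernel ec' epi_c') _.
    rewrite -compA compBl -!compA (exact0 ec') comp0r subr0 PE.
    by rewrite (compA i2) (compA k) (compA r) (proj1 rk) comp0l.
  exists h => //; apply: epi0 epi_c _.
  have [z zq] : exists z, z \oc q = r \oc (k \oc i2).
    by apply: cokernel_desc qj _; rewrite -(proj1 rk) !compA.
  move: nu => /= [h0 h0c]; rewrite compm1 => h00.
  have qt : q \oc t = 0 by rewrite -h0c h00 comp0l.
  have tE : (k \oc i1 - i3 \oc c') \oc v = k \oc (i2 \oc t).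
    rewrite compBl -!compA -l (compA i3) P'E -compA s'c i1v compDr.
    exact: addrK.
  by rewrite -compA l compA hc' -compA tE (compA k) compA -zq -compA qt comp0r.
(* Once [k \oc s] is null, [r \oc (k \oc i1) \oc v] is a sum of two null maps and induction
   applies. *)
have [P' [k [mk nk]]] := null_efface (idm X) ex se.
exists P', k, (k \oc i1); split=> //; first by rewrite compA.
move=> R r rk; apply: IHn ex ex' l _ _.
  by rewrite -!compA PE (compA i2) (compA k) (compA r) (proj1 rk) comp0l.
have [z zq] : exists z, z \oc q = r \oc (k \oc i2).
  by apply: cokernel_desc qj _; rewrite -(proj1 rk) !compA.
have -> : r \oc (k \oc i1) \oc v = z \oc (q \oc t) + r \oc (k \oc s).
  by rewrite !compA zq -!compA i1v -!compDr.
by apply: null_add; apply: null_post.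
Qed.

Lemma null_push_exact n Y Y' X (u : hom Y Y') (c : chain n.+1 Y X)
    (c' : chain n.+1 Y' X) :
  exact_chain c -> exact_chain c' -> ladder u (idm X) c c' ->
  null (idm X) u c -> null (idm X) (idm Y') c'.
Proof.
move=> /(exact_chainP Y) ex /(exact_chainP Y') ex' l nu.
have := @null_push n.+1 Y Y' Y Y' X X Y' 0 0 u (idm X) (idm Y') c c' ex ex' l.
by rewrite comp0r comp1m; apply=> //; exact: mono1.
Qed.

End Null.

(** * Yoneda equivalence *)

Definition all_null (A : preadditive) n (X Y : A) : Prop :=
  forall c : chain n.+1 Y X, exact_chain c -> null (idm X) (idm Y) c.

Section Extensions.
Context {A : abelian}.
Implicit Types X Y Z W V T E : A.

(** Exactness of Ext(X2, Y') -> Ext(X, Y') -> Ext(X1, Y'). The map from [X] to the last cokernel [Q]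
    of the coresolution kills [a], so it descends to [X2], and the last [D] is pulled back along the
    result. *)
Lemma null_factor n V Y Y' X1 X X2 (f : hom V Y) (y : hom Y Y') (a : hom X1 X)
    (b : hom X X2) (c : chain n.+1 Y X) :
  is_cokernel a b -> exact_from f c -> null a y c ->
  exists c' : chain n.+1 Y' X2, exact_chain c' /\ ladder y b c c'.
Proof.
move=> ab; elim: n V Y Y' f y c => [|n IHn] V Y Y' f y [E [e c]].
  move=> /= [_ [/exact0 ce _]] [D [Q [j [q [u [mj qj uj [h hc ha]]]]]]].
  have [h' h'b] := cokernel_desc ab ha.
  have [P [p1 [p2 [PE univ joint ep _]]]] := pullback_ex q h'.
  have [v [v1 v2]] : exists v, p1 \oc v = u /\ p2 \oc v = b \oc c.
    by apply: univ; rewrite -hc -h'b compA.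
  have [j' [j1 j2]] : exists j', p1 \oc j' = j /\ p2 \oc j' = 0.
    by apply: univ; rewrite (proj1 qj) comp0r.
  have mj' : mono j'.
    by apply: mono0P => W w w0; apply: (mono0 mj); rewrite -j1 -compA w0 comp0r.
  exists (ccons (n := 0) j' p2); split.
    split=> //; split; last by apply: ep; exact: cokernel_epi qj.
    apply/exact_kernel/kernel_intro => // W g p2g.
    have [w jw] : exists w, j \oc w = p1 \oc g.
      apply: kernel_lift (mono_kernel mj qj) _.
      by rewrite compA PE -compA p2g comp0r.
    by exists w; apply: joint; rewrite compA ?j1 ?j2 ?comp0l ?p2g.
  exists v => //=; apply: joint; rewrite !compA ?v1 ?j1 ?v2 ?j2 //.
  by rewrite -compA ce comp0r comp0l.
move=> [_ ex] [D [Q [j [q [u [mj qj uj nu]]]]]].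
have [c' [[me ex'] l]] := IHn _ _ _ _ _ _ ex nu.
exists (ccons (n := n.+1) j (precomp q c')); split.
  split=> //=; split; last exact: exact_from_epi (cokernel_epi qj) _.
  by apply: exact_mono => //; apply/exact_kernel/mono_kernel.
by exists u => //; apply/(@ladder_precompr A n.+1).
Qed.

Fixpoint zero_chain n Y Z : chain n Y Z :=
  if n is m.+1 then ccons 0 (zero_chain m Z Z) else 0.

Lemma zero_chain_exact n V Y Z (f : hom V Y) :
  zero_object Z -> epi f -> exact_from f (zero_chain n Y Z).
Proof.
move=> [Z0 Z1]; have ez W : epi (0 : hom W Z).
  by move=> T u v _; rewrite (Z1 _ u) (Z1 _ v).
elim: n V Y f => [|n IHn] V Y f ef /=; split; try exact: exact_epi0.
  exact: ez.
exact: IHn.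
Qed.

Lemma zero_chain_ladder n Y Y' X Z (c : chain n Y' Z) :
  ladder 0 (0 : hom X Z) (zero_chain n Y X) c.
Proof.
elim: n Y Y' c => [|n IHn] Y Y' c /=; first by rewrite !comp0r.
by exists 0; rewrite ?comp0l ?comp0r.
Qed.

Lemma zero_chain_ladder_exact n V Y X Z (f : hom V Y) (c : chain n Y Z) :
  exact_from f c -> ladder f (0 : hom X Z) (zero_chain n V X) c.
Proof.
case: n c => [|n] c /= [/exact0 cf _]; first by rewrite comp0l.
by exists 0; [rewrite comp0r | exact: zero_chain_ladder].
Qed.

(** [E] is the pullback to [X] of [Y = Y -> 0 -> ... -> 0]. By [null_factor], for the cokernel
    [X -> 0] of the identity, a null [F] maps to a chain [c2] ending in 0; both [E] and [F] map to
    the pullback of [c2] to [X]. *)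
Lemma split_extension n X Y : exists E : extension n X Y,
  null (idm X) (idm Y) (sval E) /\
  forall F : extension n X Y, null (idm X) (idm Y) (sval F) ->
    exists2 G : extension n X Y, extension_map E G & extension_map F G.
Proof.
have [Z Z0] := abelian_zero A.
pose c0 := ccons (idm Y) (zero_chain n Y Z).
have ex : exact_from (0 : hom Y Y) c0.
  split; first by apply/mono_exact; exact: mono1.
  exact: (@zero_chain_exact n Y Y Z (idm Y) Z0 (@epi1 A Y)).
have [c [/exact_chainP cex l _]] := chain_pullback (0 : hom X Z) ex.
exists (exist _ c cex); split.
  rewrite -[idm Y]comp1m; apply: null_pull l _.
  exists Y, Z, (idm Y), 0, (idm Y); split; first exact: mono1.
  - exact: cokernel_zero.
  - by [].
  - by rewrite comp0l; exact: null0.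
move=> [c' c'ex] /= nu.
have ab : is_cokernel (idm X) (0 : hom X Z) by exact: cokernel_zero.
have [c2 [c2ex l2]] := null_factor ab (proj1 (exact_chainP Y c') c'ex) nu.
have [c3 [/exact_chainP c3ex _ univ]] :=
  chain_pullback (0 : hom X Z) (proj1 (exact_chainP Y c2) c2ex).
have univ' c4 : exact_chain c4 -> ladder (idm Y) 0 c4 c2 -> chain_map (idm Y) c4 c3.
  move=> /(exact_chainP Y) c4ex l4.
  by apply/(@ladder_chain_map A n.+1); exact: univ c4ex l4.
exists (exist _ c3 c3ex); last exact: univ'.
apply: univ' => //.
have l0 : ladder (idm Y) (0 : hom Z Z) c0 c2.
  exists (projT2 c2).1 => //; apply: zero_chain_ladder_exact.
  by case: c2ex.
by move: (ladder_comp l l0); rewrite compm1 comp0l.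
Qed.

(** Nullity is invariant under [extension_map] in both directions and holds for the split extension;
    conversely, a null extension and the split one map to a common extension. *)
Lemma Ext_trivialP n X Y :
  (forall a b : Ext n.+1 X Y, a = b) <-> all_null n X Y.
Proof.
have [E0 [E0n E0P]] := @split_extension n X Y.
split=> [ext c cex|nu a b].
  pose E : extension n X Y := exist _ c cex.
  have : \pi_{eq_quot (@yoneda_equiv A n X Y)} E = \pi E0 by exact: ext.
  move=> /eqquotP/asboolP.
  suff step F G : clos_refl_sym_trans _ (@extension_map A n X Y) F G ->
      null (idm X) (idm Y) (sval F) <-> null (idm X) (idm Y) (sval G).
    by move=> /step ->.
  elim=> {F G} [F G /ladder_chain_map l|||]; last 1 first.
  - by move=> F G H _ -> _ ->.
  - split=> nF.
      by apply: null_push_exact l nF; [exact: (svalP F) | exact: (svalP G)].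
    by rewrite -[idm Y]comp1m; exact: null_pull l nF.
  - by [].
  - by move=> F G _ ->.
have conn (E : extension n X Y) : clos_refl_sym_trans _ (@extension_map A n X Y) E0 E.
  have /E0P[G E0G EG] := nu _ (svalP E).
  by apply: rst_trans (rst_step _ _ _ _ E0G) (rst_sym _ _ _ _ (rst_step _ _ _ _ EG)).
elim/quotW: a => E; elim/quotW: b => F; apply/eqquotP/asboolP.
exact: rst_trans (rst_sym _ _ _ _ (conn E)) (conn F).
Qed.

End Extensions.

(** * Dimension shifting *)

Section DimensionShifting.
Context {A : abelian}.
Implicit Types X Y Z W V T E : A.

(* If the class of [c] dies along [r], it lifts to the pullback of [r] and [q]. *)
Lemma null_resolve n Y E X Q D (e : hom Y E) (c : chain n E X) (r : hom E Q)
    (q : hom D Q) :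
  exact_from e c -> r \oc e = 0 -> null (idm X) r c -> epi q ->
  exists G V (k : hom V G) (c' : chain n G X) (w1 : hom G E) (w2 : hom G D),
    [/\ r \oc w1 = q \oc w2, w2 \oc k = 0, exact_from k c' & ladder w1 (idm X) c' c].
Proof.
elim: n Y E Q D e c r q => [|n IHn] Y E Q D e c r q.
  move=> ex _ /= [h hc]; rewrite compm1 => h0 _.
  exists E, Y, e, c, (idm E), 0; rewrite -hc h0 !comp0l !comp0r.
  by split; rewrite // comp1m compm1.
case: c => [E1 [e1 c]] /= [ee1 ex] re [D1 [Q1 [j1 [q1 [u1 [mj1 qj1 uj1 nu]]]]]] eq.
have [|G1 [V1 [k1 [c1 [w1 [w2 [wE wk ex1 l1]]]]]]] :=
  IHn _ _ _ _ e1 c (q1 \oc u1) q1 ex _ nu (cokernel_epi qj1).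
  by rewrite -compA uj1 compA (proj1 qj1) comp0l.
have [t jt] : exists t, j1 \oc t = u1 \oc w1 - w2.
  by apply: kernel_lift (mono_kernel mj1 qj1) _; rewrite compBr compA wE subrr.
(* [t] measures the failure of [w2] to equal [u1 \oc w1]; on the cover [P] of [G1] it lifts along
   [q]. *)
have [P [p1 [p2 [PE _ _ _ ep]]]] := pullback_ex t q.
have {}ep : epi p1 by apply: ep.
have [V' [k' [_ ex']]] := exact_from_precomp ep ex1.
have l' : ladder (w1 \oc p1) (idm X) (precomp p1 c1) c by exact: ladder_precompl.
have [W [p [w [ep' ew]]]] := ladder_lift ex' ex l'.
have [W' [p' [w' [ep'' kw]]]] := ladder_lift ex' ex1 (ladder_precomp p1 c1).
have w2k : w2 \oc (p1 \oc k') = 0.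
  by apply: epi0 ep'' _; rewrite -compA -kw compA wk comp0l.
have [K [k kk]] := abelian_kernel (k' \oc p).
exists W, K, k, (ccons (k' \oc p) (precomp p1 c1)), w, (p2 \oc (k' \oc p)); split.
- apply: mj1; rewrite compA -uj1 -compA ew (compA q) -PE -(compA t) (compA j1) jt.
  by rewrite compBl (compA p1) (compA w2) w2k comp0l subr0 -!compA.
- by rewrite -compA (proj1 kk) comp0r.
- by split; [exact: exact_kernel | exact: exact_from_epi].
- by exists (w1 \oc p1); rewrite // ew compA.
Qed.

(** Cocycle form of [null]: on a finer resolution [c'] of [X] the class is given by the cocycle [s],
    and [y \oc s] is the coboundary of [t]. *)
Lemma null_split n Y Y' X E (e : hom Y E) (c : chain n E X) (y : hom Y Y') :
  mono e -> exact_from e c -> null (idm X) y (ccons e c) ->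
  exists G V (k : hom V G) (c' : chain n G X) (w : hom G E) (t : hom G Y') (s : hom V Y),
    [/\ exact_from k c', ladder w (idm X) c' c, e \oc s = w \oc k & y \oc s = t \oc k].
Proof.
move=> me ex [D [Q [j [q [u [mj qj uj nu]]]]]]; rewrite /= in u uj nu.
have [|G [V [k [c' [w [w2 [wE wk ex' l]]]]]]] :=
  null_resolve ex _ nu (cokernel_epi qj).
  by rewrite -compA uj compA (proj1 qj) comp0l.
have [t jt] : exists t, j \oc t = u \oc w - w2.
  by apply: kernel_lift (mono_kernel mj qj) _; rewrite compBr compA wE subrr.
have [W [p [s' [ep es']]]] := ladder_lift ex' ex l.
have [s es] := mono_epi_lift me ep es'.
exists G, V, k, c', w, t, s; split=> //; apply: mj.
by rewrite compA -uj -compA es (compA j) jt compBl wk subr0 compA.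
Qed.

(** Exactness of Ext(X, Y1) -> Ext(X, Y) -> Ext(X, Y2). On a finer resolution the cochain [t] in
    [Y2] lifts to [p2] in [Y]; the cocycle [r] corrected by [p2] is killed by [b], so it comes from
    [Y1]. *)
Lemma null_kernel n Y1 Y Y2 X (a : hom Y1 Y) (b : hom Y Y2) (c : chain n.+1 Y X) :
  is_kernel b a -> epi b -> all_null n X Y1 -> exact_chain c ->
  null (idm X) b c -> null (idm X) (idm Y) c.
Proof.
case: c => E [e c] ab eb nu [/= me ex] nb.
have [G [V [k [c' [w [t [s [ex' l es bs]]]]]]]] := null_split me ex nb.
have [P [p1 [p2 [PE _ _ _ ep]]]] := pullback_ex t b.
have {}ep : epi p1 by apply: ep.
have [V' [k' [mk' ex1]]] := exact_from_precomp ep ex'.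
have l1 : ladder (w \oc p1 - e \oc p2) (idm X) (precomp p1 c') c.
  by apply: ladder_subr ex _; exact: ladder_precompl.
have [W [p [s' [ep1 es']]]] := ladder_lift ex1 ex l1.
have [r er] := mono_epi_lift me ep1 es'.
have [W' [p' [v [ep' kv]]]] := ladder_lift ex1 ex' (ladder_precomp p1 c').
have [r1 ar1] : exists r1, a \oc r1 = r.
  apply: kernel_lift ab _; apply: epi0 ep' _.
  have -> : b \oc r \oc p' = b \oc (s \oc v - p2 \oc k' \oc p').
    rewrite -compA; congr (_ \oc _); apply: me; rewrite compA er compBr.
    by rewrite !compBl !compA es -!compA kv !compA.
  by rewrite compBr !compA bs -PE -!compA kv !compA subrr.
pose c1 := ccons k' (precomp p1 c').
have c1ex : exact_chain c1 by [].
have [|c2 [c2ex l2]] := chain_pushout (y := r1) (proj1 (exact_chainP V' c1) c1ex).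
  exact: comp0r.
apply: (@null_push_exact A n V' Y X r c1 (ccons e c)) => //.
  by exists (w \oc p1 - e \oc p2); rewrite ?er.
rewrite -ar1; apply: null_post; rewrite -[r1]comp1m.
exact: null_pull l2 (nu _ c2ex).
Qed.

Lemma all_null_torsion n X1 X D T (a : hom X1 X) (b : hom X D) m :
  is_kernel (b *+ m) a -> epi (b *+ m) -> idm T *+ m = 0 ->
  all_null n X1 T -> all_null n X T.
Proof.
move=> ab eb mT nu c cex.
have cex0 := proj1 (exact_chainP T c) cex.
have [c1 [c1ex l1 _]] := chain_pullback a cex0.
have na : null a (idm T) c.
  apply: (null_push (u := idm T) c1ex cex0 l1 (kernel_mono ab)).
    exact: comp0r.
  by rewrite comp1m; apply: nu; apply/exact_chainP; exact: c1ex.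
have [c2 [/(exact_chainP T) c2ex l2]] := null_factor (epi_cokernel eb ab) cex0 na.
have [c3 [c3ex _ univ]] := chain_pullback (b *+ m) c2ex.
have [c4 [c4ex l4 _]] := chain_pullback b c2ex.
rewrite -[idm T]comp1m; apply: null_pull (univ _ _ _ _ _ cex0 l2) _.
(* The ladder from [c4] to [c2] over [b], multiplied by [m], starts at [idm T *+ m = 0] and ends at
   [b *+ m], so it factors through the pullback [c3]. *)
have l43 : ladder 0 (idm X) c4 c3.
  by apply: univ c4ex _; rewrite -mT; exact: ladder_muln.
have /exact_chainP c3ex' := c3ex; have /exact_chainP c4ex' := c4ex.
by apply: null_push_exact c4ex' c3ex' l43 _; exact: null0.
Qed.

End DimensionShifting.

(** * Exact functors and torsion objects *)

Record exact_functor (A B : abelian) := ExactFunctor {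
  fobj :> A -> B;
  fmap : forall X Y : A, hom X Y -> hom (fobj X) (fobj Y);
  fmap1 : forall X, fmap (idm X) = idm (fobj X);
  fmapM : forall X Y Z (g : hom Y Z) (f : hom X Y), fmap (g \oc f) = fmap g \oc fmap f;
  fmap_kernel : forall X Y (f : hom X Y) K (k : hom K X),
    is_kernel f k -> is_kernel (fmap f) (fmap k);
  fmap_cokernel : forall X Y (f : hom X Y) C (c : hom Y C),
    is_cokernel f c -> is_cokernel (fmap f) (fmap c)
}.

Section ExactFunctor.
Context {A B : abelian} (F : exact_functor A B).
Implicit Types X Y Z W V T E : A.

Lemma fmap0 X Y : fmap F (0 : hom X Y) = 0.
Proof.
have id0 : is_kernel (0 : hom X Y) (idm X).
  apply: kernel_intro; [exact: mono1 | exact: comp0l |].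
  by move=> W g _; exists g; rewrite comp1m.
by have [] := fmap_kernel F id0; rewrite fmap1 compm1.
Qed.

Lemma fmap_mono X Y (m : hom X Y) : mono m -> mono (fmap F m).
Proof.
move=> mm; have [C [c cm]] := abelian_cokernel m.
exact: kernel_mono (fmap_kernel F (mono_kernel mm cm)).
Qed.

Lemma fmap_epi X Y (e : hom X Y) : epi e -> epi (fmap F e).
Proof.
move=> ee; have [K [k ke]] := abelian_kernel e.
exact: cokernel_epi (fmap_cokernel F (epi_cokernel ee ke)).
Qed.

Lemma fmap_exact X Y Z (f : hom X Y) (g : hom Y Z) :
  exact f g -> exact (fmap F f) (fmap F g).
Proof.
move=> [I [m [[C [c [cf mc]]] mg]]]; exists (F I), (fmap F m).
split; last exact: fmap_kernel.
by exists (F C), (fmap F c); split; [exact: fmap_cokernel | exact: fmap_kernel].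
Qed.

Fixpoint fmap_chain n Y X : chain n Y X -> chain n (F Y) (F X) :=
  match n with
  | 0 => fun g => fmap F g
  | m.+1 => fun c => ccons (fmap F (projT2 c).1) (fmap_chain (projT2 c).2)
  end.

Lemma fmap_exact_from n V Y X (f : hom V Y) (c : chain n Y X) :
  exact_from f c -> exact_from (fmap F f) (fmap_chain c).
Proof.
elim: n V Y f c => [|n IHn] V Y f c /= [/fmap_exact fc]; first by move/fmap_epi.
by move/IHn.
Qed.

Lemma fmap_exact_chain n Y X (c : chain n.+1 Y X) :
  exact_chain c -> exact_chain (fmap_chain c).
Proof. by move=> [mc /fmap_exact_from ex]; split; [exact: fmap_mono | exact: ex]. Qed.

Lemma fmap_null n Y X X' Y' (x : hom X' X) (y : hom Y Y') (c : chain n Y X) :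
  null x y c -> null (fmap F x) (fmap F y) (fmap_chain c).
Proof.
elim: n Y Y' y c => [|n IHn] Y Y' y c /=.
  move=> [h hc hx]; exists (fmap F h); first by rewrite -fmapM hc.
  by rewrite -fmapM hx fmap0.
move=> [D [Q [j [q [u [mj qj uj nu]]]]]].
exists (F D), (F Q), (fmap F j), (fmap F q), (fmap F u); split.
- exact: fmap_mono.
- exact: fmap_cokernel.
- by rewrite -!fmapM uj.
- by rewrite -fmapM; exact: IHn.
Qed.

End ExactFunctor.

(** * Torsion objects and divisible quotients *)

Section Torsion.
Context {A : abelian} {S : set nat}.
Implicit Types X Y Z W V T E : A.

Lemma torsion_sub K X (k : hom K X) : mono k -> is_torsion S X -> is_torsion S K.
Proof.
move=> mk [n Sn Xn]; exists n => //; apply: (mono0 mk).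
by rewrite compMnr compm1 -[k]comp1m -compMnl Xn comp0l.
Qed.

Lemma torsion_quotient X C (c : hom X C) : epi c -> is_torsion S X -> is_torsion S C.
Proof.
move=> ec [n Sn Xn]; exists n => //; apply: (epi0 ec).
by rewrite compMnl comp1m -[c]compm1 -compMnr Xn comp0r.
Qed.

Lemma torsion_zero Z : zero_object Z -> is_torsion S Z.
Proof.
by move=> [_ Z1]; exists 1%N; [exact: generated1 | rewrite (Z1 _ (idm Z))].
Qed.

Lemma torsion_biproduct X1 X2 P (i1 : hom X1 P) (i2 : hom X2 P) (p1 : hom P X1)
    (p2 : hom P X2) :
  is_biproduct i1 i2 p1 p2 -> is_torsion S X1 -> is_torsion S X2 -> is_torsion S P.
Proof.
move=> [_ _ _ _ PE] [m Sm Xm] [n Sn Xn]; exists (m * n)%N; first exact: generatedM.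
have -> : idm P *+ (m * n) = i1 \oc ((idm X1 *+ m *+ n) \oc p1)
    + i2 \oc ((idm X2 *+ n *+ m) \oc p2).
  by rewrite -PE mulrnDl !(compMnl, compMnr) !comp1m -!mulrnA (mulnC n).
by rewrite Xm Xn !mul0rn !comp0l !comp0r addr0.
Qed.

Hypothesis A_artinian : artinian A.

(* [D] is the smallest of the subobjects [N Y], for [N] in <S>. *)
Lemma divisible_part Y : exists M D (p : hom Y D) (i : hom D Y),
  [/\ generated S M, epi p, mono i, i \oc p = idm Y *+ M &
      forall m, generated S m -> epi (idm D *+ m)].
Proof.
apply: contrapT => nD.
have img (M : nat) : {t : {D : A & (hom Y D * hom D Y)%type} |
    [/\ epi (projT2 t).1, mono (projT2 t).2 &
        (projT2 t).2 \oc (projT2 t).1 = idm Y *+ M]}.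
  apply: cid; have [D [p [i [ep mi ip]]]] := image_factor (idm Y *+ M).
  by exists (existT _ D (p, i)).
(* If no image is divisible, the image of each [M] has an [m] in <S> that is not epi on it;
   iterating [M], [m * M], ... gives a descending chain. *)
have step (M : {M | generated S M}) :
    {m | generated S m & ~ epi (idm (projT1 (sval (img (sval M)))) *+ m)}.
  apply: cid2; apply: contrapT => nm; apply: nD.
  case: M nm => M SM /=; case: (img M) => -[D [p i]] /= [ep mi ip] nm.
  exists M, D, p, i; split=> // m Sm; apply: contrapT => nem.
  by apply: nm; exists m.
pose next M : {M | generated S M} :=
  exist _ (s2val (step M) * sval M)%N (generatedM (s2valP (step M)) (svalP M)).
pose Ms k := iter k next (exist _ 1%N (generated1 S)).
pose t k := sval (img (sval (Ms k))).
have tP k : [/\ epi (projT2 (t k)).1, mono (projT2 (t k)).2 &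
  (projT2 (t k)).2 \oc (projT2 (t k)).1 = idm Y *+ sval (Ms k)] := svalP (img _).
pose m k := s2val (step (Ms k)).
have desc k : exists u, (projT2 (t k)).2 \oc u = (projT2 (t k.+1)).2.
  have [_ mi ip] := tP k; have [ep' _ ip'] := tP k.+1.
  apply: (mono_epi_lift mi ep' (w := (projT2 (t k)).1 *+ m k)).
  by rewrite compMnr ip ip' -mulrnA mulnC.
have [N stat] := A_artinian (fun k => let: And3 _ mi _ := tP k in mi) desc.
have [v iv] := stat N (leqnn N); have [u iu] := desc N.
have [ep mi ip] := tP N; have [ep' _ ip'] := tP N.+1.
apply: (s2valP' (step (Ms N))).
(* Where the chain stops, [u] is epi; up to the epimorphisms from [Y] it is multiplication by [m N],
   which was chosen not to be epi. *)
have uv : u \oc v = idm _ by apply: mi; rewrite compA iu iv compm1.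
have eu : epi u by apply: (@epi_compl _ _ _ _ _ v); rewrite uv; exact: epi1.
have up : u \oc (projT2 (t N.+1)).1 = (idm _ *+ m N) \oc (projT2 (t N)).1.
  apply: mi; rewrite compA iu ip' compMnl comp1m compMnr ip -mulrnA.
  by rewrite mulnC.
by apply: (@epi_compl _ _ _ _ _ (projT2 (t N)).1); rewrite -up; exact: epi_comp.
Qed.

(** [B] is the kernel of the map from [E] onto a divisible [D]. If [v \oc h] kills [B], it factors
    through [D] by some [v'] with [v' *+ n = 0], as [n] kills [X]; since [n] is epi on [D],
    [v' = 0]. *)
Lemma torsion_cover E X (h : hom E X) : epi h -> is_torsion S X ->
  exists B (i : hom B E), is_torsion S B /\ epi (h \oc i).
Proof.
move=> eh [n Sn Xn]; have [M [D [p [j [SM ep mj jp divD]]]]] := divisible_part E.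
have [B [i ip]] := abelian_kernel p; exists B, i; split.
  exists M => //; apply: (mono0 (kernel_mono ip)).
  by rewrite compMnr compm1 -[i]comp1m -compMnl -jp -compA (proj1 ip) comp0r.
apply: epi0P => T v vhi.
have [v' v'p] : exists v', v' \oc p = v \oc h.
  by apply: cokernel_desc (epi_cokernel ep ip) _; rewrite -compA.
have v'0 : v' = 0.
  apply: (epi0 (divD n Sn)); apply: (epi0 ep).
  rewrite compMnr compm1 compMnl v'p -compMnr -[h in h *+ _]comp1m -compMnl Xn.
  by rewrite comp0l comp0r.
by apply: (epi0 eh); rewrite -v'p v'0 comp0l.
Qed.

End Torsion.

(** * The torsion subcategory *)

Section TorsionMono.
Context (A : abelian) (S : set nat).
Local Notation AS := (torsion_subcategory A S).

Lemma torsion_kernel (X Y K : AS) (f : hom X Y) (k : hom K X) :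
  @is_kernel A (sval X) (sval Y) f (sval K) k -> is_kernel f k.
Proof. by move=> [fk ker]; split=> // W g; exact: ker. Qed.

Lemma torsion_monoP (X Y : AS) (m : hom X Y) :
  mono m <-> @mono A (sval X) (sval Y) m.
Proof.
split=> [mm|mm W u v]; last exact: mm.
have [K [k km]] := @abelian_kernel A (sval X) (sval Y) m.
have tK := torsion_sub (kernel_mono km) (svalP X).
have k0 : k = 0.
  apply: (mm (exist _ K tK) k 0); apply: etrans (proj1 km) _.
  exact/esym/(@comp0r A).
apply: mono0P => W u mu; have [v <-] := kernel_lift km mu.
by rewrite k0 comp0l.
Qed.

Lemma torsion_is_kernelP (X Y K : AS) (f : hom X Y) (k : hom K X) :
  is_kernel f k <-> @is_kernel A (sval X) (sval Y) f (sval K) k.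
Proof.
split=> [fk|]; last exact: torsion_kernel.
have mk : mono k.
  move=> W u v uv; case: fk => fk /(_ _ (k \oc v)) [|w [_ uniq]].
    by rewrite compA fk comp0l.
  by rewrite -(uniq _ uv) (uniq v).
apply: kernel_intro; [exact/torsion_monoP | by case: fk |].
have [K' [k' fk']] := @abelian_kernel A (sval X) (sval Y) f.
have tK' := torsion_sub (kernel_mono fk') (svalP X).
have [t [kt _]] := proj2 fk (exist _ K' tK') k' (proj1 fk').
move=> W g fg; have [u k'u] := kernel_lift fk' fg.
by exists (@comp A _ _ _ t u); rewrite compA -k'u; congr (_ \oc _).
Qed.

End TorsionMono.

Section TorsionEpi.
Context (A : abelian) (S : set nat).
Local Notation AS := (torsion_subcategory A S).

(** Torsion is self-dual: the torsion objects of [op A] are by conversion those of [A]. *)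
Lemma torsion_epiP (X Y : AS) (e : hom X Y) :
  epi e <-> @epi A (sval X) (sval Y) e.
Proof. exact: (@torsion_monoP (op_abelian A) S Y X e). Qed.

Lemma torsion_is_cokernelP (X Y C : AS) (f : hom X Y) (c : hom Y C) :
  is_cokernel f c <-> @is_cokernel A (sval X) (sval Y) f (sval C) c.
Proof. exact: (@torsion_is_kernelP (op_abelian A) S Y X C f c). Qed.

Lemma torsion_subcategory_zero : exists Z : AS, zero_object Z.
Proof.
have [Z Z0] := abelian_zero A.
exists (exist _ Z (torsion_zero Z0)).
by split=> X f; [exact: (proj1 Z0) | exact: (proj2 Z0)].
Qed.

Lemma torsion_subcategory_biproduct (X1 X2 : AS) :
  exists P (i1 : hom X1 P) (i2 : hom X2 P) (p1 : hom P X1) (p2 : hom P X2),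
    is_biproduct i1 i2 p1 p2.
Proof.
have [P [i1 [i2 [p1 [p2 bP]]]]] := @abelian_biproduct A (sval X1) (sval X2).
exists (exist _ P (torsion_biproduct bP (svalP X1) (svalP X2))), i1, i2, p1, p2.
exact: bP.
Qed.

Lemma torsion_subcategory_kernel (X Y : AS) (f : hom X Y) :
  exists K (k : hom K X), is_kernel f k.
Proof.
have [K [k fk]] := @abelian_kernel A (sval X) (sval Y) f.
exists (exist _ K (torsion_sub (kernel_mono fk) (svalP X))), k.
exact/torsion_is_kernelP.
Qed.

Lemma torsion_subcategory_cokernel (X Y : AS) (f : hom X Y) :
  exists C (c : hom Y C), is_cokernel f c.
Proof.
have [C [c fc]] := @abelian_cokernel A (sval X) (sval Y) f.
exists (exist _ C (torsion_quotient (cokernel_epi fc) (svalP Y))), c.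
exact/torsion_is_cokernelP.
Qed.

Lemma torsion_subcategory_mono (X Y : AS) (m : hom X Y) :
  mono m -> exists Z (g : hom Y Z), is_kernel g m.
Proof.
move=> /torsion_monoP mm; have [C [c cm]] := torsion_subcategory_cokernel m.
exists C, c; apply/torsion_is_kernelP; apply: mono_kernel mm _.
exact/torsion_is_cokernelP.
Qed.

Lemma torsion_subcategory_epi (X Y : AS) (e : hom X Y) :
  epi e -> exists Z (f : hom Z X), is_cokernel f e.
Proof.
move=> /torsion_epiP ee; have [K [k ke]] := torsion_subcategory_kernel e.
exists K, k; apply/torsion_is_cokernelP; apply: epi_cokernel ee _.
exact/torsion_is_kernelP.
Qed.

Definition torsion_abelian : abelian := @Abelian AS
  torsion_subcategory_zero torsion_subcategory_biproduct
  torsion_subcategory_kernel torsion_subcategory_cokernel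
  torsion_subcategory_mono torsion_subcategory_epi.

Definition torsion_inclusion : exact_functor torsion_abelian A :=
  @ExactFunctor torsion_abelian A sval (fun _ _ f => f)
    (fun _ => erefl) (fun _ _ _ _ _ => erefl)
    (fun X Y f K k => proj1 (@torsion_is_kernelP A S X Y K f k))
    (fun X Y f C c => proj1 (@torsion_is_cokernelP X Y C f c)).

End TorsionEpi.

(** * Resolutions by torsion objects *)

Section TorsionResolution.
Context (A : abelian) (S : set nat).
Hypothesis A_artinian : artinian A.
Local Notation AS := (torsion_abelian A S).
Local Notation incl := (torsion_inclusion A S).

Lemma torsion_ladder n (Y Y' X X' : AS) (u : hom Y Y') (x : hom X X')
    (c : chain n Y X) (c' : chain n Y' X') :
  ladder (fmap incl u) (fmap incl x) (fmap_chain incl c) (fmap_chain incl c') ->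
  ladder u x c c'.
Proof.
elim: n Y Y' u c c' => [|n IHn] Y Y' u c c' //= [v E l].
by exists v => //; exact: IHn.
Qed.

(** Built from the end [X]: each step has an epimorphism onto a torsion object, and [torsion_cover]
    shrinks its source to a torsion object. *)
Lemma torsion_resolution n V (Y : A) (X : AS) (f : hom V Y) (c : chain n Y (incl X)) :
  exact_from f c ->
  exists (K Y' : AS) (k : hom K Y') (c' : chain n Y' X) (u : hom (incl Y') Y),
    [/\ mono k, exact_from k c' & ladder u (idm (incl X)) (fmap_chain incl c') c].
Proof.
elim: n V Y f c => [|n IHn] V Y f c /=.
  move=> [_ ec]; have [B [i [tB eci]]] := torsion_cover A_artinian ec (svalP X).
  pose B' : AS := exist _ B tB; pose g : hom B' X := c \oc i.
  have [K [k kg]] := @abelian_kernel AS _ _ g.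
  exists K, B', k, g, i; split; first exact: kernel_mono kg.
  - by split; [exact: (@exact_kernel AS _ _ _ k g kg) | exact/torsion_epiP].
  - by rewrite comp1m.
case: c => E [e c] /= [fe ex].
have [K [E' [k [c' [u [mk ex' l]]]]]] := IHn _ _ _ _ ex.
have [W [p [w [ep ew]]]] := ladder_lift (fmap_exact_from incl ex') ex l.
have [B [i [tB epi_pi]]] := torsion_cover A_artinian ep (svalP K).
pose B' : AS := exist _ B tB; pose g : hom B' K := p \oc i.
have eg : epi g by exact/torsion_epiP.
have [K' [k' kg]] := @abelian_kernel AS _ _ (k \oc g).
exists K', B', k', (ccons (k \oc g) c'), (w \oc i); split.
- exact: kernel_mono kg.
- split; last exact: (@exact_from_epi AS).
  exact: (@exact_kernel AS _ _ _ k' (k \oc g) kg).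
- by exists u => //=; rewrite (compA e) ew -!compA.
Qed.

(** In [A] the cocycle is the coboundary of [t], and [w] corrected by [t] kills [k]. Composed with a
    torsion resolution of [c1], it gives a ladder that starts at 0 and, by fullness, lies in the
    subcategory. *)
Lemma torsion_all_null n (X Y : AS) : all_null n (incl X) (incl Y) -> all_null n X Y.
Proof.
move=> nu [E [e c]] cex; have [mi exi] := fmap_exact_chain incl cex.
have [G [V [k [c1 [w [t [s [ex1 l1 es st]]]]]]]] :=
  @null_split A n _ _ _ _ (fmap incl e) (fmap_chain incl c) _ mi exi
    (nu _ (fmap_exact_chain incl cex)).
have l2 : ladder (w - fmap incl e \oc t) (idm _) c1 (fmap_chain incl c).
  exact: ladder_subr exi l1.
have [K [Y' [k' [c' [u [mk' ex' l']]]]]] := torsion_resolution ex1.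
have [W [p [v [ep kv]]]] := ladder_lift (fmap_exact_from incl ex') ex1 l'.
pose u' : @hom AS Y' E := (w - fmap incl e \oc t) \oc u.
have u'k : u' \oc k' = 0.
  have wk : (w - fmap incl e \oc t) \oc k = 0.
    by rewrite compBl -es -compA -st comp1m subrr.
  apply: (epi0 ep).
  have -> : @comp A _ _ _ (u' \oc k') p = (w - fmap incl e \oc t) \oc (u \oc fmap incl k' \oc p).
    by rewrite !compA.
  by rewrite -kv compA wk comp0l.
have c'ex : exact_chain (ccons k' c') by [].
apply: (@null_push_exact AS n K Y X 0 (ccons k' c') (ccons e c)) => //.
  by exists u'; [apply: etrans u'k _; rewrite comp0r | apply: torsion_ladder;
    have := ladder_comp l' l2; rewrite comp1m; exact].
exact: null0.
Qed.

(** A torsion resolution exhibits the class of [c] as the image under [z] of a class between torsion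
    objects. *)
Lemma all_null_torsion_end n (X : AS) (Y : A) :
  (forall Y' : AS, all_null n X Y') -> all_null n (incl X) Y.
Proof.
move=> nu [E [e c]] cex; have [/= me ex] := cex.
have [K [Y' [k' [c' [u [mk' ex' l']]]]]] := torsion_resolution ex.
have [W [p [v [ep ev]]]] := ladder_lift (fmap_exact_from incl ex') ex l'.
have [z ez] := mono_epi_lift me ep ev.
have c'ex : exact_chain (ccons k' c') by [].
apply: (@null_push_exact A n _ _ _ z (fmap_chain incl (ccons k' c')) (ccons e c)) => //.
- exact: fmap_exact_chain c'ex.
- by exists u.
rewrite -[z]compm1; apply: null_post; exact: fmap_null (nu _ _ c'ex).
Qed.

End TorsionResolution.

(** * The Serre quotient *)

Section Localization.
Context (A : abelian) (S : set nat).
Implicit Types X Y Z W V T E : A.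
Local Notation Q := (serre_quotient A S).

Definition qloc X Y (f : hom X Y) : @hom Q X Y := roof_class (roof_of S f).

Lemma qlocM X Y Z (g : hom Y Z) (f : hom X Y) : qloc (g \oc f) = qloc g \oc qloc f.
Proof.
rewrite /qloc /= qcompE; symmetry.
apply: frac_eq (frac_comp (frac_of S g) (frac_of S f)) (frac_of S _) _.
by rewrite muln1.
Qed.

Lemma qloc1 X : qloc (idm X) = idm (X : Q).
Proof. by []. Qed.

Lemma qlocD X Y (f g : hom X Y) : qloc (f + g) = qloc f + qloc g.
Proof.
rewrite /qloc -[RHS]/(qadd _ _) qaddE; symmetry.
apply: frac_eq (frac_add (frac_of S f) (frac_of S g)) (frac_of S _) _.
by rewrite muln1.
Qed.

Lemma qlocB X Y (f g : hom X Y) : qloc (f - g) = qloc f - qloc g.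
Proof. by apply: (addIr (qloc g)); rewrite -qlocD !subrK. Qed.

Lemma qloc0 X Y : qloc (0 : hom X Y) = 0.
Proof. by []. Qed.

Lemma qlocMn X Y (f : hom X Y) n : qloc (f *+ n) = qloc f *+ n.
Proof. by elim: n => [|n IHn]; rewrite ?mulr0n // !mulrS qlocD IHn. Qed.

Lemma qloc_eq0 X Y (f : hom X Y) :
  qloc f = 0 <-> exists2 M, generated S M & f *+ M = 0.
Proof.
rewrite -qloc0 /qloc eq_class (frac_equiv (frac_of S f) (frac_of S 0)).
by split=> -[M SM E]; exists M => //; move: E; rewrite mul1n mul0rn.
Qed.

(** With [qloc_eq0], [qloc_divisible] and [qloc_torsion_free], this says that the hom groups of [Q]
    are those of [A] with <S> inverted. After these four, roofs are no longer opened. *)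
Lemma qloc_surj X Y (a : @hom Q X Y) :
  exists N (f : hom X Y), generated S N /\ a *+ N = qloc f.
Proof.
have [N [f af]] := frac_ex (rep a); exists N, f; split; first by case: af.
rewrite -[a]comp1m -compMnl -[a]repK -qloc1 -qlocMn /qloc /= qcompE.
apply: frac_eq (frac_comp (frac_of S _) af) (frac_of S _) _.
by rewrite compMnl comp1m mul1n mulr1n.
Qed.

Lemma qloc_divisible X Y (a : @hom Q X Y) N :
  generated S N -> exists b, b *+ N = a.
Proof.
move=> SN; pose d : @hom Q X X := roof_class (Roof (idm X) (Sig_muln X SN)).
have d1 : d *+ N = idm _.
  rewrite -[d]comp1m -compMnl -qloc1 -qlocMn /d /qloc /= qcompE.
  have fd : frac (Roof (idm X) (Sig_muln X SN)) N (idm X) by split; rewrite //= comp1m.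
  apply: frac_eq (frac_comp (frac_of S _) fd) (frac_of S _) _.
  by rewrite compm1 mul1n mulr1n.
by exists (a \oc d); rewrite -compMnr d1 compm1.
Qed.

Lemma qloc_torsion_free X Y (a b : @hom Q X Y) N :
  generated S N -> a *+ N = b *+ N -> a = b.
Proof.
move=> SN E; have [d dN] := qloc_divisible (idm (Y : Q)) SN.
by rewrite -[a]comp1m -[b]comp1m -dN !compMnl -!compMnr E.
Qed.

Lemma qloc_mono X Y (m : hom X Y) : mono m -> mono (qloc m).
Proof.
move=> mm; apply: mono0P => W u mu; have [N [f [SN uf]]] := qloc_surj u.
have /qloc_eq0[M SM mf] : qloc (m \oc f) = 0.
  by rewrite qlocM -uf compMnr mu mul0rn.
have fM : f *+ M = 0 by apply: (mono0 mm); rewrite compMnr.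
apply: (qloc_torsion_free SN); rewrite uf mul0rn.
by apply/qloc_eq0; exists M.
Qed.

Lemma qloc_epi X Y (e : hom X Y) : epi e -> epi (qloc e).
Proof.
move=> ee; apply: epi0P => W u ue; have [N [f [SN uf]]] := qloc_surj u.
have /qloc_eq0[M SM fe] : qloc (f \oc e) = 0.
  by rewrite qlocM -uf compMnl ue mul0rn.
have fM : f *+ M = 0 by apply: (epi0 ee); rewrite compMnl.
apply: (qloc_torsion_free SN); rewrite uf mul0rn.
by apply/qloc_eq0; exists M.
Qed.

Lemma qloc_kernel X Y (f : hom X Y) K (k : hom K X) :
  is_kernel f k -> is_kernel (qloc f) (qloc k).
Proof.
move=> fk; apply: kernel_intro; first exact: qloc_mono (kernel_mono fk).
  by rewrite -qlocM (proj1 fk).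
move=> W a fa; have [N [h [SN ah]]] := qloc_surj a.
have /qloc_eq0[M SM fh] : qloc (f \oc h) = 0 by rewrite qlocM -ah compMnr fa mul0rn.
have [u ku] : exists u, k \oc u = h *+ M.
  by apply: kernel_lift fk _; rewrite compMnr.
have [b bNM] := qloc_divisible (qloc u) (generatedM SN SM).
exists b; apply: (qloc_torsion_free (generatedM SN SM)).
by rewrite -compMnr bNM -qlocM ku qlocMn -ah mulrnA.
Qed.

Lemma qloc_cokernel X Y (f : hom X Y) C (c : hom Y C) :
  is_cokernel f c -> is_cokernel (qloc f) (qloc c).
Proof.
move=> fc; apply: cokernel_intro; first exact: qloc_epi (cokernel_epi fc).
  by rewrite -qlocM (proj1 fc).
move=> W a fa; have [N [h [SN ah]]] := qloc_surj a.
have /qloc_eq0[M SM fh] : qloc (h \oc f) = 0 by rewrite qlocM -ah compMnl fa mul0rn.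
have [u ku] : exists u, u \oc c = h *+ M.
  by apply: cokernel_desc fc _; rewrite compMnl.
have [b bNM] := qloc_divisible (qloc u) (generatedM SN SM).
exists b; apply: (qloc_torsion_free (generatedM SN SM)).
by rewrite -compMnl bNM -qlocM ku qlocMn -ah mulrnA.
Qed.

Lemma qloc_zero : exists Z : Q, zero_object Z.
Proof.
have [Z [Z0 Z1]] := abelian_zero A; exists Z; split=> X a.
  have [N [h [SN ah]]] := qloc_surj a; apply: (qloc_torsion_free SN).
  by rewrite ah (Z0 _ h) mul0rn.
have [N [h [SN ah]]] := qloc_surj a; apply: (qloc_torsion_free SN).
by rewrite ah (Z1 _ h) mul0rn.
Qed.

Lemma qloc_biproduct (X1 X2 : Q) :
  exists P (i1 : hom X1 P) (i2 : hom X2 P) (p1 : hom P X1) (p2 : hom P X2),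
    is_biproduct i1 i2 p1 p2.
Proof.
have [P [i1 [i2 [p1 [p2 [E1 E2 E3 E4 E5]]]]]] := @abelian_biproduct A X1 X2.
exists P, (qloc i1), (qloc i2), (qloc p1), (qloc p2).
by split; rewrite -!qlocM ?E1 ?E2 ?E3 ?E4 ?qloc0 // -qlocD E5.
Qed.

Lemma qloc_has_kernel (X Y : Q) (a : hom X Y) : exists K (k : hom K X), is_kernel a k.
Proof.
have [N [h [SN ah]]] := qloc_surj a; have [K [k hk]] := abelian_kernel h.
have qhk := qloc_kernel hk.
exists K, (qloc k); apply: kernel_intro; first exact: kernel_mono qhk.
  by apply: (qloc_torsion_free SN); rewrite -compMnl ah (proj1 qhk) mul0rn.
move=> W b ab; apply: kernel_lift qhk _.
by rewrite -ah compMnl ab mul0rn.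
Qed.

Lemma qloc_has_cokernel (X Y : Q) (a : hom X Y) :
  exists C (c : hom Y C), is_cokernel a c.
Proof.
have [N [h [SN ah]]] := qloc_surj a; have [C [c hc]] := abelian_cokernel h.
have qhc := qloc_cokernel hc.
exists C, (qloc c); apply: cokernel_intro; first exact: cokernel_epi qhc.
  by apply: (qloc_torsion_free SN); rewrite -compMnr ah (proj1 qhc) mul0rn.
move=> W b ab; apply: cokernel_desc qhc _.
by rewrite -ah compMnr ab mul0rn.
Qed.

(** Write [a *+ N] as [qloc (m \oc e)]. The kernel of [e] vanishes in [Q] because [a] is mono, so
    [e] is invertible up to a factor [M], and [a] is a kernel of the cokernel of [m]. *)
Lemma qloc_mono_kernel X Y (a : @hom Q X Y) :
  mono a -> exists (Z : Q) (g : hom (Y : Q) Z), is_kernel g a.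
Proof.
move=> ma; have [N [h [SN ah]]] := qloc_surj a.
have [I [e [m [ee mm me]]]] := @image_factor A _ _ h.
have [K [k ek]] := abelian_kernel e; have [C [c mc]] := abelian_cokernel m.
have /qloc_eq0[M SM kM] : qloc k = 0.
  apply: (mono0 ma); apply: (qloc_torsion_free SN).
  by rewrite -compMnl ah -qlocM -me -compA (proj1 ek) comp0r mul0rn.
have [g ge] : exists g, g \oc e = idm X *+ M.
  by apply: cokernel_desc (epi_cokernel ee ek) _; rewrite compMnl comp1m.
have eg : e \oc g = idm I *+ M.
  by apply: ee; rewrite -compA ge compMnr compMnl compm1 comp1m.
have mk := qloc_kernel (mono_kernel mm mc).
exists C, (qloc c); apply: kernel_intro => //.
  apply: (qloc_torsion_free SN).
  by rewrite -compMnr ah -me qlocM compA (proj1 mk) comp0l mul0rn.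
move=> W b cb; have [b' mb'] := kernel_lift mk cb.
have [u uM] := qloc_divisible (qloc g \oc b' *+ N) SM.
exists u; apply: (qloc_torsion_free SM); rewrite -compMnr uM compMnr -compMnl ah.
by rewrite -me qlocM -compA (compA _ _ b') -qlocM eg qlocMn compMnl comp1m compMnr mb'.
Qed.

(** Roofs are not symmetric, so this is not by conversion the previous lemma at [op A]; here [m] is
    invertible up to a factor. *)
Lemma qloc_epi_cokernel X Y (a : @hom Q X Y) :
  epi a -> exists (Z : Q) (f : hom Z (X : Q)), is_cokernel f a.
Proof.
move=> ea; have [N [h [SN ah]]] := qloc_surj a.
have [I [e [m [ee mm me]]]] := @image_factor A _ _ h.
have [K [k ek]] := abelian_kernel e; have [C [c mc]] := abelian_cokernel m.
have /qloc_eq0[M SM cM] : qloc c = 0.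
  apply: (epi0 ea); apply: (qloc_torsion_free SN).
  by rewrite -compMnr ah -qlocM -me compA (proj1 mc) comp0l mul0rn.
have [g mg] : exists g, m \oc g = idm Y *+ M.
  by apply: kernel_lift (mono_kernel mm mc) _; rewrite compMnr compm1.
have gm : g \oc m = idm I *+ M.
  by apply: mm; rewrite compA mg compMnr compMnl compm1 comp1m.
have ke := qloc_cokernel (epi_cokernel ee ek).
exists K, (qloc k); apply: cokernel_intro => //.
  apply: (qloc_torsion_free SN).
  by rewrite -compMnl ah -me qlocM -compA (proj1 ke) comp0r mul0rn.
move=> W b kb; have [b' eb'] := cokernel_desc ke kb.
have [u uM] := qloc_divisible (b' \oc qloc g *+ N) SM.
exists u; apply: (qloc_torsion_free SM); rewrite -compMnl uM compMnl -compMnr ah.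
by rewrite -me qlocM compA -(compA b') -qlocM gm qlocMn compMnr compm1 compMnl eb'.
Qed.

Definition quotient_abelian : abelian := @Abelian Q
  qloc_zero qloc_biproduct qloc_has_kernel qloc_has_cokernel
  qloc_mono_kernel qloc_epi_cokernel.

Definition quotient_functor : exact_functor A quotient_abelian :=
  @ExactFunctor A quotient_abelian id qloc qloc1 qlocM qloc_kernel qloc_cokernel.

End Localization.

(** * Devissage *)

Section Descent.
Context (A : abelian) (S : set nat).
Implicit Types X Y Z W V T E D : A.
Local Notation Q := (quotient_abelian A S).
Local Notation F := (quotient_functor A S).
Local Notation qloc := (@qloc A S _ _).

(* Clear the denominators of [j]; its kernel in [A] may still exceed the image
   of [f] by torsion, which a pushout removes. *)
Lemma qloc_exact_lift V Y D (f : hom V Y) (j : @hom Q Y D) :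
  exact (qloc f : @hom Q V Y) j ->
  exists D' (j' : hom Y D') (v : @hom Q D D') (v' : @hom Q D' D),
    [/\ exact f j', v \oc j = qloc j', v' \oc v = idm _ & v \oc v' = idm _].
Proof.
move=> fj; have [N [h [SN jh]]] := qloc_surj j.
have /qloc_eq0[M0 SM0 hf0] : qloc (h \oc f) = 0.
  by rewrite qlocM -jh compMnl (exact0 fj) mul0rn.
have {SN SM0} := generatedM SN SM0; have {jh} : j *+ (N * M0) = qloc (h *+ M0).
  by rewrite qlocMn -jh mulrnA.
have {hf0} : (h *+ M0) \oc f = 0 by rewrite compMnl.
move: {N M0 h} (h *+ M0) (N * M0)%N => h N hf jh SN.
have [C [p fp]] := abelian_cokernel f.
have [h' h'p] := cokernel_desc fp hf.
have [I [e [m [ee mm me]]]] := image_factor h'.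
(* [K] is the excess of the kernel. Its preimage [k'] in [Y] is killed by [j], so in [Q] it lifts
   through [f] locally, and some [M] kills [K]. *)
have [K [k ek]] := abelian_kernel e.
have [R [k' [r [rE _ _ er _]]]] := pullback_ex p k.
have {}er : epi r by apply: er; exact: cokernel_epi fp.
have jk' : j \oc qloc k' = 0.
  apply: (qloc_torsion_free SN); rewrite mul0rn -compMnl jh -qlocM.
  by rewrite -h'p -me -!compA rE (compA e) (proj1 ek) comp0l comp0r.
have [W [w [s [ew fs]]]] := exact_lift fj jk'.
have /qloc_eq0[M SM] : qloc (p \oc k') = 0.
  apply: (epi0 ew); rewrite qlocM -compA -fs compA -qlocM (proj1 fp).
  exact: comp0l.
rewrite rE -compMnl => /(epi0 er) kM.
have [g ge] : exists g, g \oc e = idm C *+ M.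
  by apply: cokernel_desc (epi_cokernel ee ek) _; rewrite compMnl comp1m.
have eg : e \oc g = idm I *+ M.
  by apply: ee; rewrite -compA ge compMnr compMnl compm1 comp1m.
(* As [g] inverts [e] up to [M], pushing [m] out along [g] embeds the cokernel of [f] by [i], and
   [t] becomes invertible in [Q]. *)
have [D' [t [i [tE univ joint mi _]]]] := pushout_ex m g.
have {}mi : mono i by apply: mi.
have [t' [t't t'i]] : exists t', t' \oc t = idm D *+ M /\ t' \oc i = m \oc e.
  by apply: univ; rewrite -compA eg compMnr compMnl compm1 comp1m.
have tt' : t \oc t' = idm D' *+ M.
  apply: joint; first by rewrite -compA t't compMnr compMnl compm1 comp1m.
  by rewrite -compA t'i compA tE -compA ge compMnr compMnl compm1 comp1m.
have th : t \oc h = (i \oc p) *+ M.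
  rewrite -h'p -me !compA tE -(compA i) ge compMnr compMnl compm1.
  by [].
(* [v] is [t] times [N / M] and [v'] is [t' / N]: [N] is the denominator of [j], and [M] comes from
   [th]. *)
have [v vM] := qloc_divisible (qloc t *+ N) SM.
have [v' v'N] := qloc_divisible (qloc t') SN.
exists D', (i \oc p), v, v'; split.
- by apply: exact_mono mi _; exact: exact_cokernel.
- apply: (qloc_torsion_free SM); rewrite -compMnl vM compMnl -compMnr jh -qlocM.
  by rewrite th qlocMn.
- apply: (qloc_torsion_free (generatedM SN SM)).
  rewrite mulrnA -compMnl v'N -compMnr vM compMnr -qlocM t't qlocMn -!mulrnA.
  by rewrite mulnC.
- apply: (qloc_torsion_free (generatedM SN SM)).
  rewrite mulrnA -compMnr v'N -compMnl vM compMnl -qlocM tt' qlocMn -!mulrnA.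
  by rewrite mulnC.
Qed.

(** Lifted from the start: [qloc_exact_lift] lifts one map up to an isomorphism [v] of [Q], along
    which the rest is transported. *)
Lemma quotient_chain_lift n V Y (X : Q) (f : hom V Y) (c : @chain Q n Y X) :
  exact_from (qloc f : @hom Q V Y) c ->
  exists X' (c' : chain n Y X') (x : @hom Q X X'),
    exact_from f c' /\ ladder (idm (Y : Q)) x c (fmap_chain F c').
Proof.
elim: n V Y f c => [|n IHn] V Y f c.
  move=> [/= fc ec]; have [C [p fp]] := abelian_cokernel f.
  have [x xc] : exists x, x \oc c = qloc p.
    apply: cokernel_desc (@exact_epi_cokernel Q _ _ _ _ _ fc ec) _.
    by rewrite -qlocM (proj1 fp).
  exists C, p, x; split; last by apply: etrans xc _; exact/esym/(@compm1 Q).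
  by split; [exact: exact_cokernel | exact: cokernel_epi fp].
case: c => E [e c] /= [fe ex].
have [E' [e' [v [v' [fe' ve v'v vv']]]]] := qloc_exact_lift fe.
have ex' : exact_from (qloc e' : @hom Q Y E') (precomp v' c).
  by rewrite -ve; exact: (@exact_from_iso Q).
have [X' [c' [x [c'ex l]]]] := IHn _ _ _ _ ex'.
exists X', (ccons e' c'), x; split; first by [].
exists v; first by apply: etrans ve _; exact/esym/(@compm1 Q).
have l0 : ladder v (idm X) c (precomp v' c).
  by apply/ladder_precompr; rewrite v'v; exact: ladder_id.
by have := ladder_comp l0 l; rewrite comp1m compm1.
Qed.

Lemma quotient_all_null n : (forall X Y, all_null n X Y) ->
  forall X Y : Q, all_null n X Y.
Proof.
move=> nu X Y c /(@exact_chainP Q n Y Y X) cex.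
have [X' [c' [x [/exact_chainP c'ex l]]]] :=
  @quotient_chain_lift n.+1 Y Y X (0 : hom (Y : A) Y) c cex.
rewrite -[idm Y]comp1m; apply: null_pull l _.
exact: (@fmap_null A Q F _ _ _ _ _ _ _ _ (nu _ _ _ c'ex)).
Qed.

(** The coresolution in [Q] is lifted term by term, at the cost of a factor in <S> at each term. *)
Lemma quotient_null n Y Y' X (y : hom Y Y') (c : chain n Y X) :
  null (idm (F X)) (qloc y : @hom Q Y Y') (fmap_chain F c) ->
  exists2 m, generated S m & null (idm X) (y *+ m) c.
Proof.
elim: n Y Y' y c => [|n IHn] Y Y' y c.
  move=> [h hc h1].
  have h0 : h = 0 by rewrite -[h](@compm1 Q); exact: h1.
  have /qloc_eq0[M SM yM] : qloc y = 0 by rewrite -hc h0; exact: comp0l.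
  by exists M; rewrite // yM; exists 0; rewrite comp0l.
case: c => E [e c] [D [R [j [q [u [mj qj uj nu]]]]]].
have [D' [j' [v [v' [ex' vj _ _]]]]] :=
  @qloc_exact_lift Y' Y' D 0 j (proj1 (@mono_exact Q Y' Y' D j) mj).
have mj' : mono j' by apply/(mono_exact Y').
have [R' [q' qj']] := abelian_cokernel j'.
have [L [u' [SL uL]]] := @qloc_surj A S _ _ (v \oc u).
have /qloc_eq0[M SM uM] : qloc (u' \oc e - (j' \oc y) *+ L) = 0.
  rewrite qlocB qlocMn !qlocM -uL -vj compMnl -!compA; apply/eqP; rewrite subr_eq0.
  by apply/eqP; congr (_ \oc _ *+ _); exact: uj.
have [z zq] : exists z, z \oc q = qloc q' \oc v.
  by apply: cokernel_desc qj _; rewrite -compA vj -qlocM (proj1 qj').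
have [m Sm nm] : exists2 m, generated S m & null (idm X) (q' \oc (u' *+ M) *+ m) c.
  apply: IHn.
  have -> : qloc (q' \oc (u' *+ M)) = (idm (R' : Q) *+ (L * M)) \oc (z \oc (q \oc u)).
    rewrite (compA z) zq -compA compMnl comp1m mulrnA -compMnr uL -qlocM.
    by rewrite -qlocMn -compMnr.
  by apply: null_post; apply: null_post.
(* [L] clears the denominator of [v \oc u], [M] makes the first square commute in [A], and [m]
   serves the later terms. *)
exists (L * M * m)%N; first by do !apply: generatedM.
exists D', R', j', q', (u' *+ M *+ m); split=> //; last by rewrite compMnr.
rewrite compMnl mulrnA compMnr; congr (_ *+ m).
move: uM; rewrite mulrnBl -mulrnA => /eqP; rewrite subr_eq0 => /eqP.
by rewrite compMnl => ->; rewrite compMnr.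
Qed.

End Descent.

(** * Vanishing of Ext on the three categories *)

Section Devissage.
Context (A : abelian) (S : set nat).
Hypothesis A_artinian : artinian A.
Implicit Types X Y Z W V T E D : A.

(** [m] is epi on the divisible [D], and [M * m] kills [K] because [i \oc p] is multiplication by
    [M]. *)
Lemma divisible_quotient Y m : generated S m -> exists D K (p : hom Y D) (k : hom K Y),
  [/\ epi (p *+ m), is_kernel (p *+ m) k & is_torsion S K].
Proof.
move=> Sm; have [M [D [p [i [SM ep mi ip divD]]]]] := divisible_part (S := S) A_artinian Y.
have [K [k pk]] := abelian_kernel (p *+ m); exists D, K, p, k; split=> //.
  by rewrite -[p]comp1m -compMnl; apply: epi_comp ep; exact: divD.
exists (M * m)%N; first exact: generatedM.
apply: (mono0 (kernel_mono pk)).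
by rewrite compMnr compm1 -[k]comp1m -compMnl mulrnA -ip -compMnr -compA (proj1 pk) comp0r.
Qed.

Lemma all_null_devissage n :
  (forall X Y : A, all_null n X Y) <->
  (forall X Y : torsion_abelian A S, all_null n X Y) /\
  (forall X Y : quotient_abelian A S, all_null n X Y).
Proof.
split=> [nu|[nuT nuQ] X Y c cex].
  by split=> [X Y|]; [exact: torsion_all_null | exact: quotient_all_null].
(* Torsion coefficients first, where [X'] may be replaced by the torsion kernel [K]. *)
have nT X' T : is_torsion S T -> all_null n X' T.
  move=> [m Sm mT]; have [D [K [p [k [ep pk tK]]]]] := divisible_quotient X' Sm.
  apply: all_null_torsion pk ep mT _.
  exact: (@all_null_torsion_end A S A_artinian n (exist _ K tK) T (nuT _)).
have [m Sm nm] : exists2 m, generated S m & null (idm X) (idm Y *+ m) c.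
  apply: quotient_null; apply: nuQ.
  exact: (@fmap_exact_chain A _ (quotient_functor A S) n Y X c cex).
have [D [K [p [k [ep pk tK]]]]] := divisible_quotient Y Sm.
apply: null_kernel pk ep (nT _ _ tK) cex _.
by rewrite -[p]compm1 -compMnr; exact: null_post.
Qed.

End Devissage.

(** * Homological dimension *)

(** [all_null i] concerns Ext of degree [i.+1], which turns [n < i.+1] into [n <= i]; degree 0 is
    never above [n]. *)
Lemma Ext_vanishes_aboveP (B : abelian) n :
  Ext_vanishes_above B n <-> forall i, (n <= i)%N -> forall X Y : B, all_null i X Y.
Proof.
split=> [ext i ni X Y|nu X Y [//|i] ni]; first by apply/Ext_trivialP/ext.
exact/Ext_trivialP/nu.
Qed.

Lemma hdP (B : preadditive) :
  if hd B is Some n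
  then Ext_vanishes_above B n /\ forall m, Ext_vanishes_above B m -> (n <= m)%N
  else forall m, ~ Ext_vanishes_above B m.
Proof.
rewrite /hd; case: pselect => [h|h m Bm]; last by apply: h; exists m.
by case: ex_minnP => n /asboolP Bn min; split=> // m Bm; apply/min/asboolP.
Qed.

(** Bounds are upward closed, so the least common bound of [B] and [C] is the larger of their least
    bounds, and there is none if either category has none. *)
Lemma hd_maxo (A B C : preadditive) :
  (forall n, Ext_vanishes_above A n <->
    Ext_vanishes_above B n /\ Ext_vanishes_above C n) ->
  hd A = maxo (hd B) (hd C).
Proof.
have mono (B' : preadditive) m n : (m <= n)%N ->
    Ext_vanishes_above B' m -> Ext_vanishes_above B' n.
  by move=> mn B'm X Y i ni; apply: B'm; exact: leq_ltn_trans ni.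
move=> ABC; have := hdP A; have := hdP B; have := hdP C.
case: (hd A) => [a|]; case: (hd B) => [b|]; case: (hd C) => [c|] //=.
- move=> [Cc cmin] [Bb bmin] [Aa amin]; congr Some; apply/eqP.
  have [Ba Ca] := proj1 (ABC a) Aa.
  rewrite eqn_leq geq_max bmin // cmin // amin //; apply/ABC; split.
    exact: mono (leq_maxl _ _) Bb.
  exact: mono (leq_maxr _ _) Cc.
- by move=> nC _ [/ABC[_ /nC]].
- by move=> _ nB [/ABC[/nB]].
- by move=> nC _ [/ABC[_ /nC]].
- move=> [Cc _] [Bb _] nA; case: (nA (maxn b c)); apply/ABC; split.
    exact: mono (leq_maxl _ _) Bb.
  exact: mono (leq_maxr _ _) Cc.
Qed.

Local Open Scope classical_set_scope.

Theorem theorem2p22 (A : abelian) (A_artinian : artinian A)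
    (S : set nat) (S_prime : S `<=` [set p | prime p]) :
  hd A = maxo (hd (torsion_subcategory A S)) (hd (serre_quotient A S)).
Proof.
apply: hd_maxo => n.
rewrite (Ext_vanishes_aboveP A) (Ext_vanishes_aboveP (torsion_abelian A S)).
rewrite (Ext_vanishes_aboveP (quotient_abelian A S)).
split=> [nu|[nuT nuQ] i ni].
  by split=> i /nu /(all_null_devissage S A_artinian)[].
by apply/(all_null_devissage S A_artinian); split; [exact: nuT | exact: nuQ].
Qed.
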